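(* There is a constant $C_{B,\mathbf M}$, depending only on $B$, on $\mathbf M=(\overline M_1,\dots,\overline M_K)$ and on the rate of convergence of $M_i/\sum_{l=1}^n D_l$ to $\overline M_i$, such that the following holds. Consider a sequence (indexed by $n$) of degree-corrected stochastic block models on $V=\{1,\dots,n\}$ with parameters $B$, $\boldsymbol\alpha$ (fixed), labels $\{\sigma_u\}_{u=1}^n$ and weights $0<D_1\le D_2\le\dots\le D_n$ (depending on $n$), such that: (i) $\frac{D_uD_v}{n\overline D}B_{\sigma_u\sigma_v}\le 1$ for all $u,v$; (ii) for every $i\in\{1,\dots,K\}$, $\overline D_i/\overline D\to d_i$ as $n\to\infty$ for some non-zero constant $d_i$; (iii) for all $i\ne l$ there exists $j$ such that $\frac{B_{ij}}{\overline M_i}\neq\frac{B_{lj}}{\overline M_l}$; (iv) $D_1^2/\overline D=\Omega(\log n)$; (v) either $\lim_{n\to\infty}D_1/\log n=\infty$, or both $D_1\ge C_{B,\mathbf M}\log n$ and, for some constant $c<1/2$, $\lim_{n\to\infty}D_n^2/n^c=0$. Let $\widehat H_{uv}=\frac{1}{\widehat D_u\widehat D_v}$ if $A_{uv}=1$ and $\widehat H_{uv}=0$ otherwise; $H_{uv}=\frac{1}{\mathbb E[\widehat D_u]\,\mathbb E[\widehat D_v]}A_{uv}$; $P_{uv}=\frac1{n\overline D}\frac{B_{\sigma_u\sigma_v}}{\overline M_{\sigma_u}\overline M_{\sigma_v}}$; $W=\widehat H-P$; and $\Delta(P)=\min\{|\lambda-\mu|:\lambda\ne\mu,\ \lambda,\mu\text{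 eigenvalues of }P\}$. Then, with high probability, to each normed eigenvector $\widehat{\mathbf x}$ of $\widehat H$ corresponds a normed eigenvector $\mathbf x$ of $P$ such that $$\widehat{\mathbf x}\cdot\mathbf x=1-\mathcal O\left(\left(\frac{\rho(W)}{\Delta(P)}\right)^2\right)=1-o(1),$$ where $$\rho(W)\le\rho(\widehat H-H)+\rho(H-\mathbb E[H])+\rho(\mathbb E[H]-P).$$
   Context: Degree-corrected stochastic block model. $K$ is a fixed number of communities, $S=\{1,\dots,K\}$; $B$ is a fixed symmetric $K\times K$ matrix with nonnegative real entries, independent of $n$; $\boldsymbol\alpha=(\alpha_1,\dots,\alpha_K)$ is a fixed vector of positive numbers summing to $1$. Each vertex $u\in V=\{1,\dots,n\}$ has a label $\sigma_u\in S$, with exactly $\alpha_kn$ vertices of label $k$, and a weight $D_u>0$. Labels and weights may depend on $n$. Write $\overline D=\frac1n\sum_{l=1}^nD_l$ and $\overline D_i=\frac1{\alpha_in}\sum_{u:\sigma_u=i}D_u$. The random graph has, independently for each unordered pair $u\ne v$, an edge with probability $\frac{D_uD_v}{n\overline D}B_{\sigma_u\sigma_v}$; there are no loops. $A$ is its adjacency matrix and $\widehat D_u=\sum_vA_{uv}$ is the observed degree of $u$. Put $M_i=\sum_{l=1}^nD_lB_{i\sigma_l}$ and $\overline M_i=\lim_{n\to\infty}M_i/\sum_{l}D_l=\sum_{k=1}^KB_{ik}\alpha_kd_k$, where $d_i=\lim\overline D_i/\overline D$; it is understood that $\overline M_i>0$. $\rho(X)$ denotes the spectral radius of $X$; ''normed''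 means of Euclidean norm $1$. ''With high probability'' means with probability tending to $1$ as $n\to\infty$; the constant in $\mathcal O$ and the $o(1)$ term do not depend on the eigenvector. *)

(* Defs.v *)
From mathcomp Require Import all_boot all_order all_algebra.
From mathcomp Require Import all_classical all_reals all_analysis.
From mathcomp Require Import complex.

Set Implicit Arguments.
Unset Strict Implicit.
Unset Printing Implicit Defensive.

Import Order.TTheory GRing.Theory Num.Theory.
Import numFieldNormedType.Exports.

Local Open Scope classical_set_scope.
Local Open Scope ring_scope.

Section LinearAlgebra.
Context {R : realType} {n : nat}.
Implicit Types (X : 'M[R]_n) (x y : 'cV[R]_n).

Definition spectrum X : set R[i] :=
  [set z | eigenvalue (map_mx (real_complex R) X) z].

(* The spectrum is finite, so the supremum and infimum below are a maximum and
   a minimum (except on an empty set, where they are 0). *)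
Definition spectral_radius X : R := sup [set complex.Re `|z| | z in spectrum X].

Definition spectral_gap X : R :=
  inf [set r | exists z w, [/\ spectrum X z, spectrum X w, z != w
                             & r = complex.Re `|z - w|]].

Definition dotv x y : R := \sum_i x i 0 * y i 0.

(* The library's norm on matrices is the sup norm, not the Euclidean one. *)
Definition norm2 x : R := Num.sqrt (dotv x x).

Definition normed_eigenvector X x : Prop :=
  norm2 x = 1 /\ exists a : R, X *m x = a *: x.

End LinearAlgebra.

(* A loopless simple graph on 'I_n: each unordered pair of distinct vertices,
   represented by its increasing listing, is marked as an edge or not. *)
Definition vpair (n : nat) := {e : 'I_n * 'I_n | (e.1 < e.2)%N}.
Definition graph (n : nat) := {ffun vpair n -> bool}.

Definition adjacent (n : nat) (G : graph n) (u v : 'I_n) : bool :=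
  [exists e, G e && ((val e == (u, v)) || (val e == (v, u)))].

Section ObservedGraph.
Context (R : realType) {n : nat}.
Implicit Types (G : graph n) (u v : 'I_n).

Definition adj_mx G : 'M[R]_n := \matrix_(u, v) (adjacent G u v)%:R.

Definition degree G u : R := \sum_v adj_mx G u v.

Definition Hhat_mx G : 'M[R]_n :=
  \matrix_(u, v) if adjacent G u v then (degree G u * degree G v)^-1 else 0.

End ObservedGraph.

Record dcsbm (R : realType) (K n : nat) := Dcsbm {
  label : 'I_n -> 'I_K;
  weight : 'I_n -> R
}.

Section Model.
Context {R : realType} {K n : nat}.
Variables (B : 'M[R]_K) (S : dcsbm R K n).

Definition total_weight : R := \sum_u weight S u.

Definition mean_weight : R := n%:R^-1 * total_weight.

Definition community_mean_weight (alpha : 'I_K -> R) (i : 'I_K) : R :=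
  (alpha i * n%:R)^-1 * \sum_(u | label S u == i) weight S u.

Definition Msum (i : 'I_K) : R := \sum_l weight S l * B i (label S l).

Definition edge_prob (u v : 'I_n) : R :=
  weight S u * weight S v / (n%:R * mean_weight) * B (label S u) (label S v).

(* Law of the random graph: independent edges, the pair {u, v} being an edge
   with probability [edge_prob u v]. *)
Definition graph_mass (G : graph n) : R :=
  \prod_(e : vpair n)
    let p := edge_prob (val e).1 (val e).2 in if G e then p else 1 - p.

Definition graph_prob (E : graph n -> Prop) : R :=
  \sum_(G : graph n | `[< E G >]) graph_mass G.

Definition expectation (X : graph n -> R) : R :=
  \sum_(G : graph n) graph_mass G * X G.

Definition mean_degree (u : 'I_n) : R :=
  expectation (fun G => degree R G u).

Definition H_mx (G : graph n) : 'M[R]_n :=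
  \matrix_(u, v) ((mean_degree u * mean_degree v)^-1 * adj_mx R G u v).

Definition EH_mx : 'M[R]_n :=
  \matrix_(u, v) expectation (fun G => H_mx G u v).

Definition P_mx (Mbar : 'I_K -> R) : 'M[R]_n :=
  \matrix_(u, v) ((n%:R * mean_weight)^-1 *
    (B (label S u) (label S v) / (Mbar (label S u) * Mbar (label S v)))).

Definition W_mx (Mbar : 'I_K -> R) (G : graph n) : 'M[R]_n :=
  Hhat_mx R G - P_mx Mbar.

End Model.

(* Events are indexed by m; the m-th model has n m vertices. *)
Definition with_high_probability (R : realType) (K : nat) (n : nat -> nat)
    (B : 'M[R]_K) (S : forall m, dcsbm R K (n m))
    (E : forall m, graph (n m) -> Prop) : Prop :=
  (fun m => graph_prob B (S m) (E m)) @ \oo --> (1 : R).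

(* Main.v *)
(* Davis-Kahan reduces the claim to rho(W) = o(Delta(P)), and Delta(P) is a
   constant over Dbar, because the nonzero eigenvalues of Dbar P are those of a
   fixed K x K matrix.  With e_u = E[deg u] / deg u, W is the sum of EH - P, which
   is entrywise small, of the matrix ((e_u e_v - 1) EH_uv), small because
   sum_u (e_u - 1)^2 = o(n) (Chebyshev, and Chernoff to keep e_u <= 4), and of the
   matrix (e_u e_v (H - EH)_uv).  Under (iv) matrix Bernstein bounds
   Dbar (H - EH) only by a constant, so that term is treated by the trace method
   with walks of length about 2 log n. *)

(* The delicate term is H - EH. Divided by a bound of order 1 / (Dbar log n) on its coefficients, it
   has entries at most 1 in absolute value and of variance O(log n / n). Its norm must then be below
   any given multiple of log n, whereas summing over walks one step at a time gives only O(log n).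
   The missing factor comes from vanishing means: a walk contributes only if none of its edges
   occurs exactly once, so at least half of its steps retrace an edge, and this saves a factor of
   order r^(-1/4) per step, with r of order log n. Shapes of walks are not classified: a weight that
   is a product over the steps dominates the contribution of a walk and is summed step by step.
   Since the length is of order log n, the n starting points in the trace cost only a bounded factor
   per step. All estimates are made at a fixed tolerance eta, with constants explicit in eta; a
   diagonal choice then lets eta tend to 0 along the sequence. *)
Require Import Defs.
From mathcomp Require Import all_boot all_order all_algebra.
From mathcomp Require Import all_classical all_reals all_analysis.
From mathcomp Require Import complex ring lra.

Set Implicit Arguments.
Unset Strict Implicit.
Unset Printing Implicit Defensive.

Import Order.TTheory GRing.Theory Num.Theory.
Import numFieldNormedType.Exports.

Local Open Scope classical_set_scope.
Local Open Scope ring_scope.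

(** * Quadratic forms and operator bounds *)

Section EuclideanNorm.
Context {R : realType} {n : nat}.
Implicit Types (x y : 'cV[R]_n) (X Y : 'M[R]_n).

Lemma dotvE x y : dotv x y = (x^T *m y) 0 0.
Proof. by rewrite mxE; apply: eq_bigr => i _; rewrite mxE. Qed.

Lemma dotvC x y : dotv x y = dotv y x.
Proof. by apply: eq_bigr => i _; rewrite mulrC. Qed.

Lemma dotvDr x y z : dotv x (y + z) = dotv x y + dotv x z.
Proof. by rewrite !dotvE mulmxDr mxE. Qed.

Lemma dotvZr a x y : dotv x (a *: y) = a * dotv x y.
Proof. by rewrite !dotvE -scalemxAr mxE. Qed.

Lemma dotvNr x y : dotv x (- y) = - dotv x y.
Proof. by rewrite !dotvE mulmxN mxE. Qed.

Lemma dotv0r x : dotv x 0 = 0.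
Proof. by rewrite dotvE mulmx0 mxE. Qed.

Lemma dotvZl a x y : dotv (a *: x) y = a * dotv x y.
Proof. by rewrite dotvC dotvZr dotvC. Qed.

Lemma dotv_sumr (I : finType) (P : pred I) x (F : I -> 'cV[R]_n) :
  dotv x (\sum_(i | P i) F i) = \sum_(i | P i) dotv x (F i).
Proof.
rewrite dotvE mulmx_sumr summxE; apply: eq_bigr => i _; by rewrite dotvE.
Qed.

Lemma dotv_mulmx x X y : dotv x (X *m y) = dotv (X^T *m x) y.
Proof. by rewrite !dotvE trmx_mul trmxK mulmxA. Qed.

Lemma dotvv_ge0 x : 0 <= dotv x x.
Proof. by apply: sumr_ge0 => i _; rewrite -expr2 sqr_ge0. Qed.

Lemma dotvv_eq0 x : (dotv x x == 0) = (x == 0).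
Proof.
apply/eqP/eqP => [/psumr_eq0P x0|->]; last exact: dotv0r.
apply/matrixP => i j; rewrite ord1 mxE; apply/eqP.
rewrite -sqrf_eq0 expr2; apply/eqP/x0 => // k _.
by rewrite -expr2 sqr_ge0.
Qed.

Lemma norm2_ge0 x : 0 <= norm2 x.
Proof. exact: sqrtr_ge0. Qed.

Lemma sqr_norm2 x : norm2 x ^+ 2 = dotv x x.
Proof. by rewrite sqr_sqrtr ?dotvv_ge0. Qed.

End EuclideanNorm.

(* Lagrange's identity *)
Lemma sum_cauchy_schwarz (R : realType) (I : finType) (P : pred I)
    (a b : I -> R) :
  (\sum_(i | P i) a i * b i) ^+ 2
    <= (\sum_(i | P i) a i ^+ 2) * (\sum_(i | P i) b i ^+ 2).
Proof.
have : 0 <= \sum_(i | P i) \sum_(j | P j) (a i * b j - a j * b i) ^+ 2.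
  by do 2![apply: sumr_ge0 => ? _]; apply: sqr_ge0.
have -> : \sum_(i | P i) \sum_(j | P j) (a i * b j - a j * b i) ^+ 2 =
    (\sum_(i | P i) a i ^+ 2) * (\sum_(i | P i) b i ^+ 2)
    + (\sum_(i | P i) a i ^+ 2) * (\sum_(i | P i) b i ^+ 2)
    - (\sum_(i | P i) a i * b i) ^+ 2 - (\sum_(i | P i) a i * b i) ^+ 2.
  rewrite [X in _ + X - _ - _]mulrC expr2 !big_distrlr /= -big_split -!sumrB /=.
  apply: eq_bigr => i _; rewrite -big_split -!sumrB /=.
  by apply: eq_bigr => j _; ring.
lra.
Qed.

Lemma sum_cauchy_schwarz_sqrt (R : realType) (I : finType) (P : pred I)
    (a b : I -> R) :
  \sum_(i | P i) a i * b i
    <= Num.sqrt (\sum_(i | P i) a i ^+ 2) * Num.sqrt (\sum_(i | P i) b i ^+ 2).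
Proof.
have s0 (c : I -> R) : 0 <= \sum_(i | P i) c i ^+ 2.
  by apply: sumr_ge0 => i _; exact: sqr_ge0.
apply: le_trans (ler_norm _) _.
rewrite -sqrtrM // -sqrtr_sqr ler_wsqrtr //; exact: sum_cauchy_schwarz.
Qed.

Section OperatorBound.
Context {R : realType} {n : nat}.
Implicit Types (x y : 'cV[R]_n) (X Y : 'M[R]_n).

Lemma dotv_le x y : dotv x y <= norm2 x * norm2 y.
Proof.
apply: le_trans (sum_cauchy_schwarz_sqrt _ _ _) _.
by rewrite /norm2 /dotv; under [in leRHS]eq_bigr do rewrite -expr2;
   under [X in _ <= _ * Num.sqrt X]eq_bigr do rewrite -expr2.
Qed.

(** A bound on the operator norm through the bilinear form. Unlike the spectral radius, it is
    subadditive without symmetry, and the pieces into which [W_mx] is cut are not all symmetric. *)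
Definition op_bounded X (t : R) : Prop :=
  forall x y, `|dotv x (X *m y)| <= t * (norm2 x * norm2 y).

Lemma op_bounded_le X t t' : t <= t' -> op_bounded X t -> op_bounded X t'.
Proof.
move=> tt' Xt x y; apply: le_trans (Xt x y) _.
by rewrite ler_wpM2r // mulr_ge0 ?norm2_ge0.
Qed.

Lemma op_boundedD X Y t t' :
  op_bounded X t -> op_bounded Y t' -> op_bounded (X + Y) (t + t').
Proof.
move=> Xt Yt x y; rewrite mulmxDl dotvDr mulrDl.
by apply: le_trans (ler_normD _ _) _; apply: lerD.
Qed.

Lemma op_boundedZ X t a : 0 <= a -> op_bounded X t -> op_bounded (a *: X) (a * t).
Proof.
move=> a0 Xt x y; rewrite -scalemxAl dotvZr normrM (ger0_norm a0) -mulrA.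
by rewrite ler_wpM2l.
Qed.

Lemma op_bounded_tr X t : op_bounded X t -> op_bounded X^T t.
Proof.
by move=> Xt x y; rewrite dotv_mulmx trmxK dotvC [norm2 x * _]mulrC.
Qed.

Lemma op_bounded_norm2 X t y : 0 <= t -> op_bounded X t ->
  norm2 (X *m y) <= t * norm2 y.
Proof.
move=> t0 Xt; have := le_trans (ler_norm _) (Xt (X *m y) y).
rewrite -sqr_norm2 expr2 mulrCA.
have := norm2_ge0 (X *m y); rewrite le_eqVlt => /orP[/eqP <- _|p].
  by rewrite mulr_ge0 ?norm2_ge0.
by rewrite ler_pM2l.
Qed.

(** The form is dominated by the product of the sums of [f u * |x u|] and [g v * |y v|], and
    Cauchy-Schwarz applies to each of them. *)
Lemma op_bounded_outer X (f g : 'I_n -> R) :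
  (forall u v, `|X u v| <= f u * g v) -> (forall u, 0 <= f u) ->
  (forall u, 0 <= g u) ->
  op_bounded X (Num.sqrt (\sum_u f u ^+ 2) * Num.sqrt (\sum_u g u ^+ 2)).
Proof.
move=> Xfg f0 g0 x y.
have n2 z : norm2 z = Num.sqrt (\sum_u `|z u 0| ^+ 2).
  rewrite /norm2 /dotv; congr Num.sqrt.
  by apply: eq_bigr => i _; rewrite real_normK ?num_real // expr2.
rewrite mulrACA !n2.
apply: (@le_trans _ _ ((\sum_u f u * `|x u 0|) * (\sum_v g v * `|y v 0|))).
  rewrite /dotv big_distrlr /=; apply: le_trans (ler_norm_sum _ _ _) _.
  apply: ler_sum => u _; rewrite mxE mulr_sumr.
  apply: le_trans (ler_norm_sum _ _ _) _; apply: ler_sum => v _.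
  rewrite !normrM mulrCA mulrACA; exact: ler_wpM2r (mulr_ge0 _ _) _ _ (Xfg u v).
apply: ler_pM; try exact: sum_cauchy_schwarz_sqrt.
  by apply: sumr_ge0 => u _; rewrite mulr_ge0.
by apply: sumr_ge0 => u _; rewrite mulr_ge0.
Qed.

Lemma op_bounded_frobenius X :
  op_bounded X (Num.sqrt (\sum_u \sum_v X u v ^+ 2)).
Proof.
move=> x y; rewrite pair_big /=.
have -> : dotv x (X *m y) = \sum_(p : 'I_n * 'I_n) X p.1 p.2 * (x p.1 0 * y p.2 0).
  rewrite /dotv -(pair_bigA _ (fun u v => X u v * (x u 0 * y v 0))) /=.
  by apply: eq_bigr => u _; rewrite mxE mulr_sumr; apply: eq_bigr => v _; ring.
have -> : norm2 x * norm2 y =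
   Num.sqrt (\sum_(p : 'I_n * 'I_n) (x p.1 0 * y p.2 0) ^+ 2).
  rewrite /norm2 -sqrtrM ?dotvv_ge0 //; congr Num.sqrt.
  rewrite /dotv big_distrlr -(pair_bigA _ (fun u v => (x u 0 * y v 0) ^+ 2)) /=.
  by apply: eq_bigr => u _; apply: eq_bigr => v _; ring.
rewrite -sqrtr_sqr -sqrtrM; last by apply: sumr_ge0 => p _; exact: sqr_ge0.
by rewrite ler_wsqrtr //; exact: sum_cauchy_schwarz.
Qed.

(** [X] is multiplied on both sides by the diagonal matrix of [e], of norm at most [c]. *)
Lemma op_bounded_scale X t (e : 'I_n -> R) (c : R) :
  0 <= t -> 0 <= c -> (forall u, `|e u| <= c) -> op_bounded X t ->
  op_bounded (\matrix_(u, v) (e u * e v * X u v)) (c ^+ 2 * t).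
Proof.
move=> t0 c0 ec Xt x y.
pose s (z : 'cV[R]_n) : 'cV[R]_n := \col_u (e u * z u 0).
have -> : dotv x ((\matrix_(u, v) (e u * e v * X u v)) *m y) = dotv (s x) (X *m s y).
  apply: eq_bigr => u _; rewrite !mxE !mulr_sumr; apply: eq_bigr => v _.
  by rewrite !mxE; ring.
have ns z : norm2 (s z) <= c * norm2 z.
  rewrite -[leRHS]ger0_norm ?mulr_ge0 ?norm2_ge0 // -sqrtr_sqr ler_wsqrtr //.
  rewrite exprMn sqr_norm2 /dotv mulr_sumr; apply: ler_sum => u _.
  rewrite !mxE mulrACA -!expr2 ler_wpM2r ?sqr_ge0 //.
  by rewrite -(real_normK (num_real (e u))) lerXn2r ?nnegrE.
apply: le_trans (Xt _ _) _; rewrite [c ^+ 2 * _]mulrC -mulrA ler_wpM2l //.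
by rewrite expr2 mulrACA ler_pM ?norm2_ge0.
Qed.

End OperatorBound.

(** * Spectra of symmetric matrices *)

Section Spectrum.
Context {R : realType} {n : nat}.
Implicit Types (x y : 'cV[R]_n) (X Y : 'M[R]_n).

Local Notation C := R[i].
Local Notation toC := (map_mx (real_complex R)).

Lemma Re_sum (I : finType) (F : I -> C) :
  complex.Re (\sum_i F i) = \sum_i complex.Re (F i).
Proof. exact: (raddf_sum (@complex.Re R : Rcomplex R -> R)). Qed.

Lemma Im_sum (I : finType) (F : I -> C) :
  complex.Im (\sum_i F i) = \sum_i complex.Im (F i).
Proof. exact: (raddf_sum (@complex.Im R : Rcomplex R -> R)). Qed.

Lemma toC_hermitian X : X^T = X -> toC X \is hermsymmx.
Proof.
move=> Xsym; apply/is_hermitianmxP; rewrite expr0 scale1r.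
apply/matrixP => i j; rewrite !mxE -[in LHS]Xsym mxE.
by apply/esym/conjc_real.
Qed.

(* The real and imaginary parts of a unitary eigenbasis form a tight frame of
   real eigenvectors; this replaces a real orthonormal eigenbasis. *)
Lemma eigenframe X : X^T = X ->
  exists (d : 'I_n * bool -> R) (f : 'I_n * bool -> 'cV[R]_n),
    [/\ forall j, X *m f j = d j *: f j,
        forall j, spectrum X (d j)%:C%C &
        forall x, x = \sum_j dotv (f j) x *: f j].
Proof.
move=> Xsym; have XH := toC_hermitian Xsym.
pose P := spectralmx (toC X); pose D := spectral_diag (toC X).
have Pun : P \is unitarymx := spectral_unitarymx _.
have XPD : P *m toC X = diag_mx D *m P.
  have /orthomx_spectralP e := hermitian_normalmx XH.
  by rewrite [in LHS]e !mulmxA mulmxV ?spectral_unit // mul1mx.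
have Dre i : D 0 i = (complex.Re (D 0 i))%:C%C.
  by have /mxOverP/(_ 0 i)/RRe_real := hermitian_spectral_diag_real XH.
have rowE i v : \sum_u P i u * (X u v)%:C%C = D 0 i * P i v.
  have /matrixP/(_ i v) := XPD; rewrite mul_diag_mx !mxE => <-.
  by apply: eq_bigr => u _; rewrite mxE.
pose re (z : C) (b : bool) := if b then complex.Im z else complex.Re z.
have re_realM z (a : R) b : re (z * a%:C%C) b = re z b * a.
  by case: z => z1 z2; rewrite /re; case: b => /=; ring.
have re_sum (F : 'I_n -> C) b : re (\sum_u F u) b = \sum_u re (F u) b.
  by rewrite /re; case: b; rewrite ?Re_sum ?Im_sum.
pose d (j : 'I_n * bool) := complex.Re (D 0 j.1).
pose f (j : 'I_n * bool) : 'cV[R]_n := \col_u re (P j.1 u) j.2.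
exists d, f; split.
- move=> j; apply/matrixP => v k; rewrite ord1 !mxE.
  transitivity (re (\sum_u P j.1 u * (X u v)%:C%C) j.2).
    rewrite re_sum; apply: eq_bigr => u _.
    by rewrite re_realM mxE mulrC -[in LHS]Xsym mxE.
  by rewrite rowE Dre mulrC re_realM mulrC.
- move=> [i b]; apply/eigenvalueP; exists (row i P); last first.
    apply/eqP => r0; have /(congr1 (row i)) := unitarymxP Pun.
    rewrite row_mul r0 mul0mx => /rowP/(_ i)/eqP.
    by rewrite !mxE eqxx eq_sym oner_eq0.
  rewrite -row_mul XPD; apply/matrixP => k v; rewrite ord1 /d -Dre.
  by rewrite mul_diag_mx !mxE.
- move=> x; apply/matrixP => u k; rewrite ord1 summxE.
  have PP : map_mx Num.conj P^T *m P = 1%:M.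
    by rewrite -(invmx_unitary Pun) mulVmx ?spectral_unit.
  (* The real part of the relation [PP] is the resolution of the identity by the real and imaginary
     parts of the rows of [P]. *)
  have PPre i v : complex.Re ((P i u)^* * P i v) =
      re (P i u) true * re (P i v) true + re (P i u) false * re (P i v) false.
    by case: (P i u) => a b; case: (P i v) => a' b' /=; ring.
  transitivity (\sum_v \sum_j f j u 0 * f j v 0 * x v 0); last first.
    rewrite exchange_big /=; apply: eq_bigr => j _.
    by rewrite [RHS]mxE /dotv mulr_suml; apply: eq_bigr => v _; ring.
  rewrite [RHS](bigD1 u) //= [X in _ + X]big1 ?addr0 => [|v vu].
    have PP1 := congr1 (fun M : 'M[C]_n => complex.Re (M u u)) PP.
    rewrite !mxE Re_sum eqxx /= in PP1; rewrite -mulr_suml.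
    rewrite -(pair_bigA _ (fun i b => f (i, b) u 0 * f (i, b) u 0)) /=.
    rewrite -[LHS]mul1r -[X in X * _]PP1; congr (_ * _).
    by apply: eq_bigr => i _; rewrite big_bool !mxE PPre.
  have PP0 := congr1 (fun M : 'M[C]_n => complex.Re (M u v)) PP.
  rewrite !mxE Re_sum eq_sym (negPf vu) /= in PP0; rewrite -mulr_suml.
  rewrite -(pair_bigA _ (fun i b => f (i, b) u 0 * f (i, b) v 0)) /=.
  rewrite -[RHS](mul0r (x v 0)) -[X in _ = X * _]PP0; congr (_ * _).
  by apply: eq_bigr => i _; rewrite big_bool !mxE PPre.
Qed.

End Spectrum.

(** * Spectral radius, spectral gap and the Davis-Kahan bound *)

Section SpectralRadius.
Context {R : realType} {n : nat}.
Implicit Types (x y : 'cV[R]_n) (X Y : 'M[R]_n) (z w : R[i]).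

Lemma Re_normc z :
  complex.Re `|z| = Num.sqrt (complex.Re z ^+ 2 + complex.Im z ^+ 2).
Proof. by rewrite normc_def. Qed.

Lemma Re_norm_real (a : R) : complex.Re `|a%:C%C| = `|a|.
Proof. by rewrite Re_normc /= expr0n addr0 sqrtr_sqr. Qed.

Lemma Re_normM z w : complex.Re `|z * w| = complex.Re `|z| * complex.Re `|w|.
Proof. by rewrite normrM !normc_def /= mul0r subr0. Qed.

Lemma Re_norm_ge0 z : 0 <= complex.Re `|z|.
Proof. by rewrite Re_normc sqrtr_ge0. Qed.

Lemma Re_norm_gt0 z : z != 0 -> 0 < complex.Re `|z|.
Proof.
move=> z0; have : 0 < `|z| by rewrite normr_gt0.
by rewrite ltcE /= => /andP[].
Qed.

(** A complex left eigenvector splits into real vectors [a] and [b]. The real matrix [X^T] acts on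
    each of them, and multiplies the sum of their squared norms by |z|^2. *)
Lemma spectrum_le X t z :
  0 <= t -> op_bounded X t -> spectrum X z -> complex.Re `|z| <= t.
Proof.
move=> t0 Xt /eigenvalueP[v vX v0].
pose a : 'cV[R]_n := \col_u complex.Re (v 0 u).
pose b : 'cV[R]_n := \col_u complex.Im (v 0 u).
have vXE u : \sum_w v 0 w * (X w u)%:C%C = z * v 0 u.
  have /rowP/(_ u) := vX; rewrite !mxE => <-.
  by apply: eq_bigr => w _; rewrite mxE.
have aE u : (X^T *m a) u 0 = complex.Re (z * v 0 u).
  rewrite -vXE mxE Re_sum; apply: eq_bigr => w _.
  by rewrite !mxE /=; case: (v 0 w) => ? ?; rewrite /= mulr0 subr0 mulrC.
have bE u : (X^T *m b) u 0 = complex.Im (z * v 0 u).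
  rewrite -vXE mxE Im_sum; apply: eq_bigr => w _.
  by rewrite !mxE /=; case: (v 0 w) => ? ?; rewrite /= mulr0 add0r mulrC.
have normE : norm2 (X^T *m a) ^+ 2 + norm2 (X^T *m b) ^+ 2 =
    (complex.Re z ^+ 2 + complex.Im z ^+ 2) * (norm2 a ^+ 2 + norm2 b ^+ 2).
  rewrite !sqr_norm2 /dotv -!big_split mulr_sumr /=; apply: eq_bigr => u _.
  by rewrite aE bE !mxE; case: z {vX vXE aE bE} => ? ?; case: (v 0 u) => ? ? /=; ring.
have ab0 : 0 < norm2 a ^+ 2 + norm2 b ^+ 2.
  rewrite lt_def addr_ge0 ?sqr_ge0 // andbT paddr_eq0 ?sqr_ge0 //.
  rewrite !sqr_norm2 !dotvv_eq0; apply: contra v0 => /andP[/eqP a0 /eqP b0].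
  apply/eqP/rowP => u; rewrite mxE; apply/eqP; rewrite eq_complex /=.
  have /matrixP/(_ u 0) := a0; have /matrixP/(_ u 0) := b0.
  by rewrite !mxE => -> ->; rewrite eqxx.
rewrite Re_normc -(ger0_norm t0) -sqrtr_sqr ler_wsqrtr //.
rewrite -(ler_pM2r ab0) -normE mulrDr -!exprMn.
by apply: lerD; rewrite lerXn2r ?nnegrE ?mulr_ge0 ?norm2_ge0 //;
  apply: op_bounded_norm2 => //; apply: op_bounded_tr.
Qed.

Lemma spectral_radius_ub X z :
  spectrum X z -> complex.Re `|z| <= spectral_radius X.
Proof.
move=> Xz; apply: ub_le_sup; last by exists z.
exists (Num.sqrt (\sum_u \sum_v X u v ^+ 2)) => _ [w Xw <-].
by apply: spectrum_le Xw; [exact: sqrtr_ge0|exact: op_bounded_frobenius].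
Qed.

Lemma spectral_radius_ge0 X : 0 <= spectral_radius X.
Proof.
have [[z Xz]|s0] := pselect (spectrum X !=set0).
  exact: le_trans (Re_norm_ge0 z) (spectral_radius_ub Xz).
suff: spectrum X = set0 by rewrite /spectral_radius => ->; rewrite image_set0 sup0.
by apply/seteqP; split => // z Xz; apply: s0; exists z.
Qed.

Lemma spectral_radius_le X t :
  0 <= t -> op_bounded X t -> spectral_radius X <= t.
Proof.
move=> t0 Xt; have [[z Xz]|s0] := pselect (spectrum X !=set0).
  apply: ge_sup; first by exists (complex.Re `|z|); exists z.
  by move=> _ [w Xw <-]; exact: spectrum_le Xw.
suff: spectrum X = set0 by rewrite /spectral_radius => ->; rewrite image_set0 sup0.
by apply/seteqP; split => // z Xz; apply: s0; exists z.
Qed.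

(** Parseval's identity, valid for a tight frame even if it is not a basis. *)
Lemma frame_dotv (J : finType) (f : J -> 'cV[R]_n) x y :
  (forall x, x = \sum_j dotv (f j) x *: f j) ->
  dotv x y = \sum_j dotv (f j) x * dotv (f j) y.
Proof.
move=> fE; rewrite {1}(fE x) dotvC dotv_sumr; apply: eq_bigr => j _.
by rewrite dotvZr [dotv y _]dotvC.
Qed.

(** The frame diagonalizes the form, with coefficients that are eigenvalues. Together with
    [spectral_radius_le], this identifies the spectral radius of a symmetric matrix with its
    operator norm. *)
Lemma op_bounded_spectral_radius X :
  X^T = X -> op_bounded X (spectral_radius X).
Proof.
move=> Xsym x y; have [d [f [Xf Xd fE]]] := eigenframe Xsym.
have fX j y' : dotv (f j) (X *m y') = d j * dotv (f j) y'.
  by rewrite dotv_mulmx Xsym Xf dotvZl.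
rewrite (frame_dotv _ _ fE).
apply: (@le_trans _ _ (\sum_j spectral_radius X *
    (`|dotv (f j) x| * `|dotv (f j) y|))).
  apply: le_trans (ler_norm_sum _ _ _) _; apply: ler_sum => j _.
  rewrite fX mulrCA !normrM ler_wpM2r ?mulr_ge0 //.
  by rewrite -Re_norm_real; exact: spectral_radius_ub.
rewrite -mulr_sumr ler_wpM2l ?spectral_radius_ge0 //.
apply: le_trans (sum_cauchy_schwarz_sqrt _ _ _) _.
rewrite /norm2 !(frame_dotv _ _ fE).
under eq_bigr do rewrite real_normK ?num_real // expr2.
under [X in _ * Num.sqrt X <= _]eq_bigr do rewrite real_normK ?num_real // expr2.
by [].
Qed.

Lemma spectral_radiusD X Y : X^T = X -> Y^T = Y ->
  spectral_radius (X + Y) <= spectral_radius X + spectral_radius Y.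
Proof.
move=> Xs Ys; apply: spectral_radius_le.
  by rewrite addr_ge0 ?spectral_radius_ge0.
by apply: op_boundedD; exact: op_bounded_spectral_radius.
Qed.

Lemma spectral_gap_le X z w : spectrum X z -> spectrum X w -> z != w ->
  spectral_gap X <= complex.Re `|z - w|.
Proof.
move=> Xz Xw zw; apply: ge_inf; last by exists z, w.
by exists 0 => _ [? [? [_ _ _ ->]]]; exact: Re_norm_ge0.
Qed.

(** Two distinct eigenvalues are asked for because the infimum of the empty set is 0. *)
Lemma spectral_gap_ge X t : (exists z w, [/\ spectrum X z, spectrum X w & z != w]) ->
  (forall z w, spectrum X z -> spectrum X w -> z != w -> t <= complex.Re `|z - w|) ->
  t <= spectral_gap X.
Proof.
move=> [z [w [Xz Xw zw]]] tX; apply: lb_le_inf; first by exists (complex.Re `|z - w|), z, w.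
by move=> _ [? [? [? ? ? ->]]]; exact: tX.
Qed.

(* [d j0] is the eigenvalue of [X] closest to the eigenvalue [a] of [X + Y], so
   all others are at distance at least [spectral_gap X / 2] from [a]. *)
Lemma davis_kahan X Y t xh : X^T = X -> 0 <= t -> op_bounded Y t ->
  0 < spectral_gap X -> 4 * (t / spectral_gap X) ^+ 2 < 1 ->
  normed_eigenvector (X + Y) xh ->
  exists2 x, normed_eigenvector X x &
    `|1 - dotv xh x| <= 4 * (t / spectral_gap X) ^+ 2.
Proof.
set D := spectral_gap X => Xsym t0 Yt D0 q1 [nxh [a XYa]].
have [d [f [Xf Xd fE]]] := eigenframe Xsym.
have fX j y' : dotv (f j) (X *m y') = d j * dotv (f j) y'.
  by rewrite dotv_mulmx Xsym Xf dotvZl.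
pose c j := dotv (f j) xh.
have c1 : \sum_j c j ^+ 2 = 1.
  rewrite -(expr1n _ 2) -nxh sqr_norm2 (frame_dotv _ _ fE).
  by apply: eq_bigr => j _; rewrite expr2.
have [j1 _|j0] := pickP (@predT ('I_n * bool)%type); last first.
  by move: c1; rewrite big_pred0 // => /eqP; rewrite eq_sym oner_eq0.
have [j0 _ j0min] := @Order.TotalTheory.arg_minP _ _ _ j1 predT (fun j => `|d j - a|) isT.
have far j : d j != d j0 -> D / 2 <= `|d j - a|.
  move=> dj; have : D <= `|d j - d j0|.
    rewrite -Re_norm_real rmorphB.
    apply: (spectral_gap_le (Xd j) (Xd j0)); apply: contra dj => /eqP e.
    by apply/eqP; case: e.
  have := j0min j isT; have := ler_distD a (d j) (d j0).
  by rewrite [`|a - d j0|]distrC; lra.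
pose s := \sum_(j | d j == d j0) c j ^+ 2.
(* The vector [a *: xh - X *m xh] equals [Y *m xh], of norm at most [t]; its coordinates outside the
   eigenspace of [d j0] are those of [xh] multiplied by at least [D / 2] in absolute value. *)
have s_ge : 1 - s <= 4 * (t / D) ^+ 2.
  have -> : 1 - s = \sum_(j | d j != d j0) c j ^+ 2.
    by rewrite -c1 [X in X - _](bigID (fun j => d j == d j0)) /= -/s; ring.
  have : \sum_j (d j - a) ^+ 2 * c j ^+ 2 <= t ^+ 2.
    have -> : \sum_j (d j - a) ^+ 2 * c j ^+ 2 = norm2 (Y *m xh) ^+ 2.
      have -> : Y *m xh = a *: xh - X *m xh.
        by rewrite -XYa mulmxDl addrC addKr.
      rewrite sqr_norm2 (frame_dotv _ _ fE); apply: eq_bigr => j _.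
      by rewrite dotvDr dotvNr fX dotvZr -/(c j); ring.
    rewrite lerXn2r ?nnegrE ?norm2_ge0 //.
    by have := op_bounded_norm2 xh t0 Yt; rewrite nxh mulr1.
  rewrite (bigID (fun j => d j == d j0)) /= => h.
  have : \sum_(j | d j != d j0) (D / 2) ^+ 2 * c j ^+ 2 <= t ^+ 2.
    apply: le_trans h; rewrite -[leLHS]add0r; apply: lerD.
      by apply: sumr_ge0 => j _; rewrite mulr_ge0 ?sqr_ge0.
    apply: ler_sum => j dj; rewrite ler_wpM2r ?sqr_ge0 //.
    rewrite -(real_normK (num_real (d j - a))) lerXn2r ?nnegrE ?far //.
    by rewrite divr_ge0 // ltW.
  rewrite -mulr_sumr => h2; rewrite expr_div_n mulrA ler_pdivlMr ?exprn_gt0 //.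
  by move: h2; rewrite expr_div_n; lra.
(* The projection of [xh] to the eigenspace of [d j0]. It is nonzero since [s > 0], which is where
   the error bound is assumed to be less than 1. *)
pose y := \sum_(j | d j == d j0) c j *: f j.
have xy : dotv xh y = s.
  by rewrite dotv_sumr; apply: eq_bigr => j _; rewrite dotvZr dotvC expr2.
have Xy : X *m y = d j0 *: y.
  rewrite /y mulmx_sumr scaler_sumr; apply: eq_bigr => j /eqP dj.
  by rewrite -scalemxAr Xf dj !scalerA mulrC.
have s0 : 0 < s by lra.
have y0 : 0 < norm2 y.
  rewrite lt_def norm2_ge0 andbT -sqrf_eq0 sqr_norm2 dotvv_eq0.
  by apply: contraL s0 => /eqP y0; rewrite -xy y0 dotv0r ltxx.
have ys : norm2 y <= Num.sqrt s.
  rewrite -(ler_pM2r y0) -expr2 sqr_norm2 {2}/y dotv_sumr.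
  under eq_bigr do rewrite dotvZr dotvC.
  apply: le_trans (sum_cauchy_schwarz_sqrt _ _ _) _.
  rewrite ler_wpM2l ?sqrtr_ge0 // ler_wsqrtr // (frame_dotv _ _ fE).
  rewrite [leRHS](bigID (fun j => d j == d j0)) /= -[leLHS]addr0; apply: lerD.
    by apply: ler_sum => j _; rewrite expr2.
  by apply: sumr_ge0 => j _; rewrite -expr2 sqr_ge0.
have ny : norm2 ((norm2 y)^-1 *: y) = 1.
  apply/eqP; rewrite -(@eqrXn2 _ 2) ?norm2_ge0 // expr1n sqr_norm2.
  rewrite dotvZr dotvZl -sqr_norm2; apply/eqP.
  by field; rewrite gt_eqF.
exists ((norm2 y)^-1 *: y).
  by split=> //; exists (d j0); rewrite -scalemxAr Xy !scalerA mulrC.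
have le1 : dotv xh ((norm2 y)^-1 *: y) <= 1.
  by apply: le_trans (dotv_le _ _) _; rewrite nxh ny mulr1.
(* The scalar product is [s / norm2 y], and [norm2 y <= sqrt s <= 1] makes it at least [s]. *)
rewrite ger0_norm ?subr_ge0 //; apply: le_trans s_ge; rewrite lerD2l lerN2.
rewrite dotvZr xy mulrC ler_pdivlMr //; apply: ler_piMr; first exact: ltW.
apply: le_trans ys _; rewrite -sqrtr1 ler_wsqrtr // -c1.
rewrite [leRHS](bigID (fun j => d j == d j0)) /= lerDl.
by apply: sumr_ge0 => j _; exact: sqr_ge0.
Qed.

End SpectralRadius.

(** * Walks in which every edge is repeated *)

Lemma sum_bool_card (T : finType) (P : pred T) : (\sum_x (P x) = #|P|)%N.
Proof. by rewrite -sum1_card [RHS]big_mkcond. Qed.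

Lemma size_undup_count2 (T : eqType) (r : seq T) :
  (forall e, count_mem e r != 1%N) -> (2 * size (undup r) <= size r)%N.
Proof.
move=> r1; rewrite -[in leqRHS](perm_size (perm_count_undup r)) size_flatten.
rewrite /shape -map_comp sumnE big_map -sum1_size mulnC big_distrl /=.
rewrite big_seq [leqRHS]big_seq; apply: leq_sum => e; rewrite mem_undup => er.
rewrite size_nseq mul1n; move: (r1 e); rewrite -has_pred1 has_count in er.
by case: (count_mem e r) er => [|[|]].
Qed.

Section Walks.
Context {n : nat}.
Implicit Types (x y z : 'I_n) (s : seq 'I_n) (es : seq ('I_n * 'I_n)).

(** Loops are kept, as pairs [(x, x)]. They lie outside [vpair], so that [centered_pair] sends them
    to 0, in accordance with the zero diagonal. *)
Definition edge x y : 'I_n * 'I_n := if (x <= y)%N then (x, y) else (y, x).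

Lemma edgeC x y : edge x y = edge y x.
Proof. by rewrite /edge; case: ltngtP => // /val_inj ->. Qed.

Lemma edge_inj x : injective (edge x).
Proof. by move=> y z; rewrite /edge; do 2![case: leqP => ?] => -[] *; subst. Qed.

Lemma card_edge_fiber (e : 'I_n * 'I_n) :
  (\sum_x \sum_z (edge x z == e : nat) <= 2)%N.
Proof.
rewrite pair_big /= sum_bool_card.
have [p /eqP pe|no] := pickP [pred p : 'I_n * 'I_n | edge p.1 p.2 == e]; last first.
  by rewrite eq_card0 // => p; rewrite -[in LHS]topredE /=; exact: no.
apply: (@leq_trans #|[set (p.1, p.2); (p.2, p.1)]%SET|); last first.
  by rewrite cards2; case: eqP.
apply/subset_leq_card/fintype.subsetP => -[x z]; rewrite !inE /= => /eqP.
rewrite -{}pe; case: p => a b; rewrite /edge /=; do 2![case: leqP => ?] => -[-> ->];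
  by rewrite !eqxx ?orbT.
Qed.

Fixpoint walk_edges x s : seq ('I_n * 'I_n) :=
  if s is y :: s' then edge x y :: walk_edges y s' else [::].

Lemma size_walk_edges x s : size (walk_edges x s) = size s.
Proof. by elim: s x => //= y s IH x; rewrite IH. Qed.

Fixpoint words k : seq (seq 'I_n) :=
  if k is k'.+1 then [seq y :: s | y <- enum 'I_n, s <- words k'] else [:: [::]].

Lemma size_words k s : s \in words k -> size s = k.
Proof.
elim: k s => [|k IH] s /=; first by rewrite inE => /eqP ->.
by move=> /allpairsP[[y s'] [_ /= /IH <- ->]].
Qed.

Lemma big_words_recl (V : nmodType) k (F : seq 'I_n -> V) :
  \sum_(s <- words k.+1) F s = \sum_y \sum_(s <- words k) F (y :: s).
Proof. by rewrite big_allpairs_dep big_enum. Qed.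

Definition edge_deg es x : nat := #|[set z | edge x z \in es]%SET|.

Lemma edge_degE es x : edge_deg es x = (\sum_z (edge x z \in es))%N.
Proof. by rewrite sum_bool_card; apply: eq_card => z; rewrite !inE. Qed.

(** The handshake bound: an edge is counted at no more than two endpoints. *)
Lemma sum_edge_deg es : (\sum_x edge_deg es x <= 2 * size es)%N.
Proof.
have memE (e : 'I_n * 'I_n) : ((e \in es) <= \sum_(e' <- es) (e == e'))%N.
  elim: es => [|e' es IH]; first by rewrite big_nil.
  by rewrite big_cons inE; case: eqP => //= _; rewrite add0n.
apply: (@leq_trans (\sum_(e <- es) \sum_x \sum_z (edge x z == e))%N).
  rewrite exchange_big /=; apply: leq_sum => x _; rewrite exchange_big /= edge_degE.
  by apply: leq_sum => z _; exact: memE.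
rewrite -sum1_size mulnC big_distrl /=; apply: leq_sum => e _.
by rewrite mul1n card_edge_fiber.
Qed.

Lemma edge_deg_cons e es x : (edge_deg (e :: es) x <= (edge_deg es x).+1)%N.
Proof.
rewrite /edge_deg; have -> : [set z | edge x z \in e :: es]%SET =
    ([set z | edge x z == e] :|: [set z | edge x z \in es])%SET.
  by apply/setP => z; rewrite !inE.
rewrite cardsU (leq_trans (leq_subr _ _)) // -[in leqRHS]add1n leq_add2r.
have [z /eqP ze|no] := pickP [pred z | edge x z == e]; last first.
  by rewrite eq_card0 // => z; rewrite inE; exact: no.
rewrite -(cards1 z); apply/subset_leq_card/fintype.subsetP => z'.
by rewrite !inE -ze => /eqP/edge_inj ->.
Qed.

Lemma edge_deg_gt0 es x y : edge x y \in es -> (0 < edge_deg es x)%N.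
Proof. by move=> xy; apply/card_gt0P; exists y; rewrite inE. Qed.

(** * Weights that are multiplicative along a walk *)

Section WalkWeight.
Context {R : realType}.
Variables (tau r : R).

(* [step_weight es y x] majorizes the cost of extending, by a step from [y] to
   [x], a walk with edge list [es].  The factor [tau] is charged for a new edge;
   the other two terms are chosen so that their geometric mean rewards a
   repeated edge out of [y]: if [y] has few neighbours through
   [r / edge_deg es y], and otherwise through the term [edge_deg _ y] of the
   previous step, which led to [y]. *)
Definition step_weight es y x : R :=
  (if edge x y \in es then 1 else tau) + (edge_deg es x)%:R
  + (if edge x y \in es then r / (edge_deg es y)%:R else 0).

(** Walks grow at the head of the list: [x] is the vertex reached last, and the tail is the history
    of the step from [y] to [x]. *)
Fixpoint walk_weight x s : R :=
  if s is y :: s' then step_weight (walk_edges y s') y x * walk_weight y s' else 1.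

Hypotheses (tau_ge0 : 0 <= tau) (tau_le1 : tau <= 1) (r_ge2 : 2 <= r).

Lemma step_weight_ge0 es y x : 0 <= step_weight es y x.
Proof.
move: tau_ge0 tau_le1 r_ge2 => tau0 tau1 r2.
have r0 : 0 <= r by lra.
by rewrite /step_weight !addr_ge0 //; case: ifP => // _; rewrite ?divr_ge0.
Qed.

Lemma walk_weight_ge0 x s : 0 <= walk_weight x s.
Proof. by elim: s x => //= y s IH x; rewrite mulr_ge0 ?step_weight_ge0. Qed.

(** The division by [edge_deg es y] makes the third term sum to at most [r] over the neighbours of
    [y]; the handshake bound controls the terms that involve degrees. *)
Lemma sum_step_weight es y :
  tau * n%:R + 4 * (size es)%:R <= r -> \sum_x step_weight es y x <= 2 * r.
Proof.
move: tau_ge0 tau_le1 r_ge2 => tau0 tau1 r2.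
move=> hr; rewrite /step_weight !big_split /=.
have dyE : \sum_x (if edge x y \in es then 1 else 0 : R) = (edge_deg es y)%:R.
  rewrite edge_degE natr_sum; apply: eq_bigr => x _; rewrite edgeC.
  by case: (_ \in _).
have h1 : \sum_x (if edge x y \in es then 1 else tau) <= tau * n%:R + (edge_deg es y)%:R.
  rewrite -dyE -[X in tau * X%:R]card_ord mulr_natr -sumr_const -big_split /=.
  by apply: ler_sum => x _; case: ifP => _; lra.
have h2 : \sum_x (edge_deg es x)%:R <= 2 * (size es)%:R :> R.
  by rewrite -natr_sum -natrM ler_nat sum_edge_deg.
have h2' : (edge_deg es y)%:R <= 2 * (size es)%:R :> R.
  by apply: le_trans h2; rewrite (bigD1 y) //= lerDl sumr_ge0.
have h3 : \sum_x (if edge x y \in es then r / (edge_deg es y)%:R else 0) <= r.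
  have -> : \sum_x (if edge x y \in es then r / (edge_deg es y)%:R else 0) =
      (edge_deg es y)%:R * (r / (edge_deg es y)%:R).
    by rewrite -dyE mulr_suml; apply: eq_bigr => x _; case: ifP; rewrite ?mul1r ?mul0r.
  have [->|d0] := eqVneq (edge_deg es y) 0%N; first by rewrite mul0r; lra.
  by rewrite mulrC divfK // pnatr_eq0.
lra.
Qed.

Lemma sum_walk_weight k K : (k <= K)%N -> tau * n%:R + 4 * K%:R <= r ->
  \sum_x \sum_(s <- words k) walk_weight x s <= n%:R * (2 * r) ^+ k.
Proof.
move: tau_ge0 tau_le1 r_ge2 => tau0 tau1 r2.
elim: k => [|k IH] kK hr.
  under eq_bigr do rewrite big_seq1; by rewrite sumr_const card_ord expr0 mulr1.
under eq_bigr do rewrite big_words_recl /=.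
rewrite exchange_big /= exprSr mulrA.
have r0 : 0 <= 2 * r by lra.
apply: le_trans (ler_wpM2r r0 (IH (ltnW kK) hr)); rewrite mulr_suml.
apply: ler_sum => y _; rewrite exchange_big /= mulr_suml.
rewrite big_seq [leRHS]big_seq; apply: ler_sum => s /size_words ss.
rewrite -mulr_suml mulrC ler_wpM2l ?walk_weight_ge0 //; apply: sum_step_weight.
apply: le_trans hr; rewrite lerD2l ler_wpM2l // size_walk_edges ss.
by rewrite ler_nat ltnW.
Qed.

(** The factor [Num.max 1 _] is a potential. A step stores the degree of the vertex it reaches; if
    the next step repeats an edge, its term [r / edge_deg es y] times the stored degree is at least
    [r / 2]. Weights are squared because the square of a sum of two nonnegative terms dominates
    their product, here of that term with [1 + edge_deg es x], which stores the new degree. In the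
    square a new edge is charged [tau ^+ 2]. *)
Lemma walk_weight_ge x s (es := walk_edges x s) :
  tau ^+ (2 * size (undup es)) * (r / 2) ^+ (size es - size (undup es))
    * Num.max 1 (edge_deg (behead es) x)%:R <= walk_weight x s ^+ 2.
Proof.
move: tau_ge0 tau_le1 r_ge2 => tau0 tau1 r2.
rewrite /es {es}; elim: s x => [|y s IH] x /=.
  rewrite !expr0 !mul1r expr1n ge_max lexx /= /edge_deg.
  by rewrite eq_card0 // => z; rewrite inE.
have r20 : 0 <= r / 2 by lra.
have {}IH := IH y; set es := walk_edges y s in IH *.
(* The potential was stored before the step into [y], which can add one edge at [y]. Hence the true
   degree is at most [2 * m], and the gain is [r / 2] instead of [r]. *)
have dy : (edge_deg es y <= (edge_deg (behead es) y).+1)%N.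
  by case: (es) => [|e es'] //=; exact: edge_deg_cons.
set m : R := Num.max 1 (edge_deg (behead es) y)%:R in IH *.
have m1 : 1 <= m by rewrite le_max lexx.
have dym : (edge_deg es y)%:R <= 2 * m.
  have : (edge_deg (behead es) y)%:R <= m by rewrite le_max lexx orbT.
  by move: dy; rewrite -(ler_nat R) -natr1; lra.
set A := tau ^+ _ * _ in IH; set dx : R := (edge_deg es x)%:R.
have dx0 : 0 <= dx by [].
have A0 : 0 <= A by rewrite mulr_ge0 ?exprn_ge0.
have maxdx : Num.max 1 dx <= 1 + dx by rewrite ge_max; apply/andP; split; lra.
have max0 : 0 <= Num.max 1 dx by rewrite le_max ler01.
rewrite [leRHS]exprMn; have [old|new] := boolP (edge x y \in es).
  have d0 : 0 < (edge_deg es y)%:R :> R.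
    by rewrite ltr0n (@edge_deg_gt0 _ _ x) // edgeC.
  rewrite /= subSn ?size_undup //.
  have -> : tau ^+ (2 * size (undup es)) * (r / 2) ^+ (size es - size (undup es)).+1
      * Num.max 1 dx = r / 2 * Num.max 1 dx * A by rewrite exprS /A; ring.
  apply: le_trans (ler_wpM2l (sqr_ge0 _) IH).
  rewrite [A * m]mulrC [leRHS]mulrA ler_wpM2r //.
  have q0 : 0 <= r / (edge_deg es y)%:R by rewrite divr_ge0 //; lra.
  rewrite /step_weight old -/dx.
  apply: (@le_trans _ _ (((1 + dx) * (r / (edge_deg es y)%:R)) * m)); last first.
    by rewrite ler_wpM2r //; [lra|nra].
  have h : r / 2 <= r / (edge_deg es y)%:R * m.
    by rewrite mulrAC ler_pdivlMr //; nra.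
  by rewrite -[leRHS]mulrA [leRHS]mulrC; apply: ler_pM.
rewrite /= subSS mulnS exprD.
have -> : tau ^+ 2 * tau ^+ (2 * size (undup es)) *
   (r / 2) ^+ (size es - size (undup es)) * Num.max 1 dx
   = tau ^+ 2 * Num.max 1 dx * A by rewrite /A; ring.
apply: (@le_trans _ _ (tau ^+ 2 * Num.max 1 dx * (A * m))).
  by rewrite ler_wpM2l ?mulr_ge0 ?sqr_ge0 // ler_peMr.
have m0 : 0 <= m by lra.
apply: ler_pM => //; [exact: mulr_ge0 (sqr_ge0 _) _|exact: mulr_ge0|].
rewrite /step_weight (negPf new) -/dx addr0 /dx.
have tau2 : 0 <= tau ^+ 2 <= 1 by rewrite sqr_ge0 expr_le1.
case: (edge_deg es x) => [|d]; first by rewrite addr0 max_l ?ler01 // mulr1.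
have d1 : 1 <= d.+1%:R :> R by rewrite ler1n.
by rewrite max_r //; move: (d.+1%:R : R) d1 => D D1; nra.
Qed.

(* Every edge of a walk of length [2 p] that repeats all its edges is charged
   twice, so at least [p] of its steps gain a factor [Num.sqrt (r / 2)]. *)
Lemma sum_even_walks p : tau * n%:R + 8 * p%:R <= r ->
  \sum_x \sum_(s <- words (2 * p) |
      [forall e, count_mem e (walk_edges x s) != 1%N])
    tau ^+ size (undup (walk_edges x s))
  <= n%:R * (2 * r) ^+ (2 * p) * Num.sqrt (2 / r) ^+ p.
Proof.
move: tau_ge0 tau_le1 r_ge2 => tau0 tau1 r2.
move=> hr; have r0 : 0 < r by lra.
set k := Num.sqrt (2 / r).
have k0 : 0 <= k := sqrtr_ge0 _.
have hr' : tau * n%:R + 4 * (2 * p)%N%:R <= r.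
  by rewrite natrM mulrA -natrM.
apply: (@le_trans _ _ (\sum_x \sum_(s <- words (2 * p)) walk_weight x s * k ^+ p)).
  apply: ler_sum => x _; rewrite big_mkcond big_seq [leRHS]big_seq.
  apply: ler_sum => s /size_words ss; case: ifP => [/forallP two|_]; last first.
    by rewrite mulr_ge0 ?walk_weight_ge0 ?exprn_ge0.
  have := size_undup_count2 two; rewrite size_walk_edges ss leq_mul2l /= => up.
  rewrite -ler_sqr ?nnegrE ?mulr_ge0 ?walk_weight_ge0 ?exprn_ge0 //.
  have q0 : 0 <= 2 / r by rewrite divr_ge0 // ltW.
  rewrite [leRHS]exprMn [k ^+ p ^+ 2]exprAC /k sqr_sqrtr //.
  rewrite -ler_pdivrMr ?exprn_gt0 ?divr_gt0 // -exprVn invf_div.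
  apply: le_trans (walk_weight_ge x s).
  rewrite -exprM mulnC size_walk_edges ss -[leLHS]mulr1.
  have q1 : 0 <= r / 2 by rewrite divr_ge0 // ltW.
  apply: ler_pM; [by rewrite mulr_ge0 ?exprn_ge0 | by [] | | by rewrite le_max lexx].
  rewrite ler_wpM2l ?exprn_ge0 // ler_weXn2l //; first lra.
  by rewrite mul2n -addnn -addnBA // leq_addr.
under eq_bigr do rewrite -mulr_suml; rewrite -mulr_suml.
by rewrite ler_wpM2r ?exprn_ge0 //; exact: (sum_walk_weight (leqnn _)).
Qed.

End WalkWeight.
End Walks.

(** * The random graph and the trace method *)

Section MatrixPowers.
Context {R : realType} {n : nat}.

Lemma mx_pow_walks (Z : 'I_n.+1 * 'I_n.+1 -> R) k x z :
  ((\matrix_(u, v) Z (edge u v)) ^+ k) x z =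
  \sum_(s <- words k | last x s == z) \prod_(e <- walk_edges x s) Z e.
Proof.
elim: k x => [|k IH] x.
  by rewrite big_mkcond big_seq1 /= expr0 mxE big_nil; case: eqP.
rewrite exprS mxE [RHS]big_mkcond big_words_recl; apply: eq_bigr => y _.
rewrite mxE IH mulr_sumr -big_mkcond /=; apply: eq_bigr => s _.
by rewrite big_cons.
Qed.

Lemma trmx_expr (X : 'M[R]_n.+1) k : X^T = X -> (X ^+ k)^T = X ^+ k.
Proof.
move=> Xs; elim: k => [|k IH]; first by rewrite expr0 trmx1.
by rewrite exprS trmx_mul IH Xs mulmxE -exprSr exprS.
Qed.

(** By symmetry the trace of [X ^+ (2 * p)] is the squared Frobenius norm of [X ^+ p], and this norm
    bounds the eigenvalue [w ^+ p]. The trace need not be written as a sum over eigenvalues. *)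
Lemma op_bounded_trace (X : 'M[R]_n.+1) p t : X^T = X -> 0 <= t -> (0 < p)%N ->
  \sum_x (X ^+ (2 * p)) x x <= t ^+ (2 * p) -> op_bounded X t.
Proof.
move=> Xs t0 p0 trX; apply: op_bounded_le (op_bounded_spectral_radius Xs).
have trE : \sum_x (X ^+ (2 * p)) x x = \sum_u \sum_v (X ^+ p) u v ^+ 2.
  apply: eq_bigr => u _; rewrite mul2n -addnn exprD mxE; apply: eq_bigr => v _.
  by rewrite -[in X in _ * X](trmx_expr p Xs) mxE expr2.
have [[z Xz]|s0] := pselect (spectrum X !=set0); last first.
  suff: spectrum X = set0 by rewrite /spectral_radius => ->; rewrite image_set0 sup0.
  by apply/seteqP; split => // z Xz; apply: s0; exists z.
apply: ge_sup; first by exists (complex.Re `|z|); exists z.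
move=> _ [w /eigenvalueP[v vX v0] <-].
have Xw : spectrum (X ^+ p) (w ^+ p).
  apply/eigenvalueP; exists v => //; rewrite rmorphXn /=.
  elim: (p) => [|k IH]; first by rewrite !expr0 mulmx1 scale1r.
  by rewrite exprS -mulmxE mulmxA vX -scalemxAl IH scalerA -exprS.
have := spectrum_le (sqrtr_ge0 _) (op_bounded_frobenius (X ^+ p)) Xw.
have -> : complex.Re `|w ^+ p| = complex.Re `|w| ^+ p.
  elim: (p) => [|k IH]; first by rewrite !expr0 normr1.
  by rewrite !exprS Re_normM IH.
move=> h; rewrite -(@ler_pXn2r _ (2 * p)) ?nnegrE ?Re_norm_ge0 ?muln_gt0 //.
apply: le_trans trX; rewrite trE mulnC exprM -[leRHS]sqr_sqrtr; last first.
  by do 2![apply: sumr_ge0 => ? _]; exact: sqr_ge0.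
by rewrite ler_sqr ?nnegrE ?exprn_ge0 ?Re_norm_ge0 ?sqrtr_ge0.
Qed.

End MatrixPowers.

(** * Expectation and probability over independent edges *)

Section RandomGraph.
Context {R : realType} {K n : nat}.
Variables (B : 'M[R]_K) (S : dcsbm R K n).
Implicit Types (G : graph n) (X Y : graph n -> R) (e : vpair n).

Definition vpair_prob e : R := edge_prob B S (val e).1 (val e).2.

Local Notation p := vpair_prob.
Local Notation expectation := (Defs.expectation B S).
Local Notation graph_prob := (graph_prob B S).

(** Independence of the edges enters through this identity: a sum over graphs of products over pairs
    is a product of sums over the two states of a pair. *)
Lemma expect_prod (F : vpair n -> bool -> R) :
  expectation (fun G => \prod_e F e (G e)) =
  \prod_e (p e * F e true + (1 - p e) * F e false).
Proof.
under [RHS]eq_bigr => e _.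
  rewrite (_ : _ + _ = \sum_b (if b then p e else 1 - p e) * F e b); last first.
    by rewrite big_bool.
  over.
rewrite bigA_distr_bigA /=; apply: eq_bigr => G _.
by rewrite -big_split.
Qed.

Lemma expect_eq X Y : X =1 Y -> expectation X = expectation Y.
Proof. by move=> XY; apply: eq_bigr => G _; rewrite XY. Qed.

Lemma expect_sum I (r : seq I) (P : pred I) (F : I -> graph n -> R) :
  expectation (fun G => \sum_(i <- r | P i) F i G) =
  \sum_(i <- r | P i) expectation (F i).
Proof.
rewrite [RHS]exchange_big; apply: eq_bigr => G _; by rewrite mulr_sumr.
Qed.

Lemma expectZ a X : expectation (fun G => a * X G) = a * expectation X.
Proof. by rewrite mulr_sumr; apply: eq_bigr => G _; rewrite mulrCA. Qed.

Lemma expect_const a : expectation (fun _ => a) = a.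
Proof.
transitivity (a * expectation (fun G => \prod_(e : vpair n) 1)).
  by rewrite -expectZ; apply: expect_eq => G; rewrite big1 ?mulr1.
by rewrite (expect_prod (fun _ _ => 1)) big1 ?mulr1 // => e _; ring.
Qed.

Hypothesis p01 : forall e, 0 <= p e <= 1.

Lemma graph_mass_ge0 G : 0 <= graph_mass B S G.
Proof.
apply: prodr_ge0 => e _ /=; have /andP[p0 p1] := p01 e.
by case: ifP => _ //; rewrite subr_ge0.
Qed.

Lemma expect_le X Y : (forall G, X G <= Y G) -> expectation X <= expectation Y.
Proof. by move=> XY; apply: ler_sum => G _; rewrite ler_wpM2l ?graph_mass_ge0. Qed.

Lemma graph_probE (E : graph n -> Prop) :
  graph_prob E = expectation (fun G => `[< E G >]%:R).
Proof.
rewrite /Defs.graph_prob big_mkcond; apply: eq_bigr => G _.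
by case: ifP; rewrite ?mulr1 ?mulr0.
Qed.

Lemma graph_prob_le (E F : graph n -> Prop) :
  (forall G, E G -> F G) -> graph_prob E <= graph_prob F.
Proof.
move=> EF; rewrite !graph_probE; apply: expect_le => G; rewrite ler_nat.
by case: asboolP => // EG; case: asboolP => // FG; case: FG; exact: EF.
Qed.

Lemma graph_prob_le1 (E : graph n -> Prop) : graph_prob E <= 1.
Proof.
rewrite graph_probE -[leRHS](expect_const 1); apply: expect_le => G.
by rewrite lern1 leq_b1.
Qed.

Lemma graph_prob_ge0 (E : graph n -> Prop) : 0 <= graph_prob E.
Proof.
by rewrite graph_probE -[leLHS](expect_const 0); apply: expect_le.
Qed.

Lemma graph_probC (E : graph n -> Prop) :
  graph_prob E = 1 - graph_prob (fun G => ~ E G).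
Proof.
rewrite !graph_probE -[X in X - _](expect_const 1) -sumrB; apply: eq_bigr => G _.
by rewrite asbool_neg; case: `[< E G >] => /=; ring.
Qed.

Lemma graph_prob_or (E F : graph n -> Prop) :
  graph_prob (fun G => E G \/ F G) <= graph_prob E + graph_prob F.
Proof.
rewrite !graph_probE -big_split /=; apply: ler_sum => G _.
rewrite -mulrDr ler_wpM2l ?graph_mass_ge0 // -natrD ler_nat.
by case: asboolP => // -[] H; rewrite (asboolT H) ?addn1 ?addnS.
Qed.

Lemma graph_prob_ex (I : finType) (E : I -> graph n -> Prop) :
  graph_prob (fun G => exists i, E i G) <= \sum_i graph_prob (E i).
Proof.
under eq_bigr do rewrite graph_probE.
rewrite graph_probE -expect_sum; apply: expect_le => G.
case: asboolP => [[i Ei]|_]; last exact: sumr_ge0.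
by rewrite (bigD1 i) //= (asboolT Ei) lerDl sumr_ge0.
Qed.

Lemma markov_graph X t : 0 < t -> (forall G, 0 <= X G) ->
  graph_prob (fun G => t <= X G) <= expectation X / t.
Proof.
move=> t0 X0; rewrite graph_probE mulrC -expectZ; apply: expect_le => G.
case: asboolP => [tX|_]; last by rewrite mulr_ge0 ?invr_ge0 // ltW.
by rewrite mulrC ler_pdivlMr ?mul1r.
Qed.

End RandomGraph.

(** * Moments of products of centered edge variables *)

Section CenteredMatrix.
Context {R : realType} {K n : nat}.
Variables (B : 'M[R]_K) (S : dcsbm R K n) (c : vpair n -> R) (tau : R).
Implicit Types (G : graph n) (e : vpair n).

Local Notation p := (vpair_prob B S).
Local Notation expectation := (Defs.expectation B S).

(** The coefficient [c] is 1 for the variance of degrees, and the rescaled inverse of a product of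
    two mean degrees for H - EH. *)
Definition centered_edge G e : R := c e * ((G e)%:R - p e).

Definition centered_pair G (a : 'I_n * 'I_n) : R :=
  if insub a is Some e then centered_edge G e else 0.

Hypothesis p01 : forall e, 0 <= p e <= 1.
Hypothesis tau_ge0 : 0 <= tau.
Hypothesis c_le1 : forall e, `|c e| <= 1.
Hypothesis c_var : forall e, c e ^+ 2 * p e <= tau.

Let moment e k : R := p e * (c e * (1 - p e)) ^+ k + (1 - p e) * (c e * (0 - p e)) ^+ k.

Lemma moment1 e : moment e 1 = 0.
Proof. by rewrite /moment !expr1; ring. Qed.

(** The first moment is 0. In the others the powers beyond the second are powers of numbers at most
    1 in absolute value, which leaves the variance [c e ^+ 2 * p e * (1 - p e)]. *)
Lemma moment_le e k : (0 < k)%N -> `|moment e k| <= tau.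
Proof.
case: k => [//|[_|k _]].
  rewrite moment1 normr0; apply: le_trans (c_var e); rewrite mulr_ge0 ?sqr_ge0 //.
  by case/andP: (p01 e).
have c1 := c_le1 e.
move: (p01 e) (c_var e); rewrite /moment; move: (p e) => P /andP[p0 p1] cv.
have small (a : R) : `|a| <= 1 -> `|(c e * a) ^+ k.+2| <= c e ^+ 2 * `|a| ^+ 2.
  move=> a1; rewrite exprMn normrM !normrX.
  have cn : `|c e| ^+ 2 = c e ^+ 2 by rewrite real_normK ?num_real.
  rewrite -addn2 exprD cn.
  have h1 : `|c e| ^+ k <= 1 by rewrite exprn_ile1.
  have h2 : `|a| ^+ (k + 2) <= `|a| ^+ 2.
    by rewrite exprD ler_piMl ?exprn_ge0 // exprn_ile1.
  rewrite -mulrA -[leRHS]mul1r; apply: ler_pM; [exact: exprn_ge0| |exact: h1|].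
    by rewrite mulr_ge0 ?sqr_ge0 ?exprn_ge0.
  by rewrite ler_wpM2l ?sqr_ge0.
have s1 := small (1 - P); have s2 := small (0 - P).
have q1 : `|1 - P| = 1 - P by rewrite ger0_norm ?subr_ge0.
have q2 : `|0 - P| = P by rewrite sub0r normrN ger0_norm.
rewrite q1 in s1; rewrite q2 in s2.
have {}s1 : `|(c e * (1 - P)) ^+ k.+2| <= c e ^+ 2 * (1 - P) ^+ 2 by apply: s1; lra.
have {}s2 := s2 p1.
apply: le_trans (ler_normD _ _) _.
rewrite [`|P * _|]normrM [`|(1 - P) * _|]normrM q1 (ger0_norm p0).
apply: le_trans (lerD (ler_wpM2l p0 s1) (ler_wpM2l _ s2)) _; first lra.
apply: le_trans cv.
have -> : P * (c e ^+ 2 * (1 - P) ^+ 2) + (1 - P) * (c e ^+ 2 * P ^+ 2) =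
    c e ^+ 2 * P * (1 - P) by ring.
have : 0 <= c e ^+ 2 * P by rewrite mulr_ge0 ?sqr_ge0.
by move=> q0; apply: ler_piMr => //; lra.
Qed.

(** An edge that occurs exactly once contributes its mean, 0; any other distinct edge of the list
    contributes at most [tau]. *)
Lemma expect_centered (es : seq (vpair n)) :
  `|expectation (fun G => \prod_(e <- es) centered_edge G e)|
  <= if [forall e, count_mem e es != 1%N] then tau ^+ size (undup es) else 0.
Proof.
have -> : expectation (fun G => \prod_(e <- es) centered_edge G e) =
    \prod_e moment e (count_mem e es).
  transitivity (expectation (fun G => \prod_e
      (fun e (b : bool) => (c e * (b%:R - p e)) ^+ count_mem e es) e (G e))).
    apply: expect_eq => G; rewrite -prodr_undup_exp_count /=.
    rewrite big_uniq ?undup_uniq //= big_mkcond /=; apply: eq_bigr => e _.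
    rewrite mem_undup; case: ifPn => // /count_memPn ->; by rewrite expr0.
  exact: (expect_prod B S (fun e b => (c e * (b%:R - p e)) ^+ count_mem e es)).
rewrite normr_prod; case: ifPn => [_|]; last first.
  rewrite negb_forall => /existsP[e]; rewrite negbK => /eqP e1.
  by rewrite (bigD1 e) //= e1 moment1 normr0 mul0r.
have -> : tau ^+ size (undup es) = \prod_e (if e \in es then tau else 1).
  rewrite -big_mkcond /= -(eq_bigl _ _ (mem_undup es)) -big_uniq ?undup_uniq //=.
  by rewrite big_const_seq count_predT iter_mulr_1.
apply: ler_prod => e _; rewrite normr_ge0 /=.
case: ifPn => [ees|/count_memPn ->].
  by apply: moment_le; rewrite -has_count has_pred1.
by rewrite /moment !expr0 !mulr1 addrC subrK normr1.
Qed.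

(** A pair that is not increasing makes the product vanish; a list of increasing pairs pulls back
    along [val] with the same multiplicities. *)
Lemma expect_centered_pair (es : seq ('I_n * 'I_n)) :
  `|expectation (fun G => \prod_(a <- es) centered_pair G a)|
  <= if [forall a, count_mem a es != 1%N] then tau ^+ size (undup es) else 0.
Proof.
have tau0 k : 0 <= tau ^+ k by exact: exprn_ge0.
have [/allP es_in|] := boolP (all (fun a : 'I_n * 'I_n => a.1 < a.2)%N es); last first.
  move=> /allPn[a aes /negP an].
  rewrite (@expect_eq _ _ _ B S _ (fun=> 0)); last first.
    move=> G; rewrite (big_rem a) //= /centered_pair insubF ?mul0r //.
    exact/negbTE/negP.
  by rewrite expect_const normr0; case: ifP.
have [es' ->] : exists es', es = map val (es' : seq (vpair n)).
  exists (pmap insub es); rewrite (pmap_filter (insubK _)).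
  apply/esym/all_filterP; rewrite (eq_all (isSome_insub _)).
  by apply/allP => a /es_in.
rewrite (@expect_eq _ _ _ B S _ (fun G => \prod_(e <- es') centered_edge G e)); last first.
  by move=> G; rewrite big_map; apply: eq_bigr => e _; rewrite /centered_pair valK.
apply: le_trans (expect_centered _) _.
rewrite (undup_map_inj val_inj) size_map.
case: ifPn => [/forallP two|_]; last by case: ifP.
case: ifPn => // /forallP[] a; rewrite count_map.
have [e _ <-|na] := insubP (vpair n) a.
  apply: contra (two e) => /eqP <-; apply/eqP; apply: eq_count => e' /=.
  by rewrite val_eqE.
rewrite (@eq_count _ _ pred0) ?count_pred0 // => e' /=.
by apply/negbTE; apply: contra na => /eqP <-; exact: (valP e').
Qed.

Definition centered_mx G : 'M[R]_n := \matrix_(u, v) centered_pair G (edge u v).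

Lemma centered_mx_sym G : (centered_mx G)^T = centered_mx G.
Proof. by apply/matrixP => u v; rewrite !mxE edgeC. Qed.

End CenteredMatrix.

(** * The trace bound for a centered matrix *)

Section TraceMethod.
Context {R : realType} {K n : nat}.
Variables (B : 'M[R]_K) (S : dcsbm R K n.+1) (c : vpair n.+1 -> R) (tau r : R).

Local Notation p := (vpair_prob B S).
Local Notation expectation := (Defs.expectation B S).

Hypothesis p01 : forall e, 0 <= p e <= 1.
Hypotheses (tau_ge0 : 0 <= tau) (tau_le1 : tau <= 1) (r_ge2 : 2 <= r).
Hypothesis c_le1 : forall e, `|c e| <= 1.
Hypothesis c_var : forall e, c e ^+ 2 * p e <= tau.

Lemma expect_trace_le q : tau * n.+1%:R + 8 * q%:R <= r ->
  expectation (fun G => \sum_x (centered_mx B S c G ^+ (2 * q)) x x) <=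
  n.+1%:R * (2 * r) ^+ (2 * q) * Num.sqrt (2 / r) ^+ q.
Proof.
move=> hr; apply: le_trans (sum_even_walks tau_ge0 tau_le1 r_ge2 hr).
rewrite expect_sum; apply: ler_sum => x _.
rewrite (expect_eq B S (fun G => mx_pow_walks (centered_pair B S c G) (2 * q) x x)) expect_sum.
rewrite big_mkcond [leRHS]big_mkcond; apply: ler_sum => s _.
case: ifP => _; last by case: ifP => // _; exact: exprn_ge0.
apply: le_trans (ler_norm _) _.
by have := expect_centered_pair p01 tau_ge0 c_le1 c_var (walk_edges x s).
Qed.

Lemma graph_prob_centered_mx q t : (0 < q)%N -> 0 < t ->
  tau * n.+1%:R + 8 * q%:R <= r ->
  graph_prob B S (fun G => ~ op_bounded (centered_mx B S c G) t) <=
  n.+1%:R * (2 * r) ^+ (2 * q) * Num.sqrt (2 / r) ^+ q / t ^+ (2 * q).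
Proof.
move=> q0 t0 hr; pose T G := \sum_x (centered_mx B S c G ^+ (2 * q)) x x.
apply: (@le_trans _ _ (graph_prob B S (fun G => t ^+ (2 * q) <= T G))).
  apply: graph_prob_le => // G nb; apply/ltW; rewrite ltNge; apply/negP => Tt.
  apply: nb; apply: op_bounded_trace Tt => //; last exact: ltW.
  exact: centered_mx_sym.
apply: (@le_trans _ _ (expectation T / t ^+ (2 * q))).
  apply: markov_graph => //; first exact: exprn_gt0.
  move=> G; apply: sumr_ge0 => x _; rewrite mul2n -addnn exprD mxE.
  apply: sumr_ge0 => y _.
  by rewrite -[in X in _ * X](trmx_expr q (centered_mx_sym B S c G)) mxE -expr2 sqr_ge0.
apply: ler_wpM2r; last exact: expect_trace_le.
by rewrite invr_ge0 exprn_ge0 // ltW.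
Qed.

End TraceMethod.

(** * Degrees *)

Section Degrees.
Context {R : realType} {K n : nat}.
Variables (B : 'M[R]_K) (S : dcsbm R K n).
Implicit Types (G : graph n) (e : vpair n) (u v : 'I_n).

Local Notation p := (vpair_prob B S).
Local Notation expectation := (Defs.expectation B S).
Local Notation graph_prob := (Defs.graph_prob B S).
Local Notation deg := (Defs.degree R).

Lemma edge_val u v : (u < v)%N -> edge u v = (u, v).
Proof. by move=> uv; rewrite /edge ltnW. Qed.

Lemma edge_vpair e : edge (val e).1 (val e).2 = val e.
Proof. by rewrite edge_val ?(valP e) //; case: (val e). Qed.

Lemma insub_edge_vpair e u v :
  (insub (edge u v) == Some e) = (val e == (u, v)) || (val e == (v, u)).
Proof.
apply/eqP/idP => [|h].
  case: insubP => // e' _ + [<-]; rewrite /edge => ->.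
  by case: ifP => _; rewrite eqxx ?orbT.
suff -> : edge u v = val e by rewrite valK.
by rewrite -edge_vpair; case/orP: h => /eqP -> //; rewrite edgeC.
Qed.

Lemma adjacentE G u v : Defs.adjacent G u v = oapp G false (insub (edge u v)).
Proof.
apply/existsP/idP => [[e /andP[Ge]]|].
  by rewrite -insub_edge_vpair => /eqP ->.
case uv : (insub _) => [e|//] Ge; exists e; rewrite -insub_edge_vpair uv eqxx.
by rewrite andbT.
Qed.

Lemma adjacentC G u v : Defs.adjacent G u v = Defs.adjacent G v u.
Proof. by rewrite !adjacentE edgeC. Qed.

Definition incident u e : bool := (u == (val e).1) || (u == (val e).2).

Lemma sum_incident u (F : vpair n -> R) :
  \sum_v oapp F 0 (insub (edge u v)) = \sum_(e | incident u e) F e.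
Proof.
have oappE a : oapp F 0 a = \sum_e (if a == Some e then F e else 0).
  case: a => [e|]; last by rewrite big1.
  rewrite (bigD1 e) //= eqxx big1 ?addr0 // => e' ee'.
  by case: eqP => // -[e'E]; rewrite e'E eqxx in ee'.
under eq_bigr do rewrite oappE.
rewrite exchange_big [RHS]big_mkcond; apply: eq_bigr => e _.
under eq_bigr do rewrite insub_edge_vpair; rewrite /incident.
case: e => -[a b] /= ab; have ne : a != b by rewrite neq_ltn ab.
have [->|ua] := eqVneq u a.
  rewrite (bigD1 b) //= eqxx big1 ?addr0 // => v vb.
  by rewrite !xpair_eqE /= [b == v]eq_sym (negPf vb) (eq_sym b) (negPf ne) !andbF.
have [->|ub] := eqVneq u b.
  rewrite (bigD1 a) //= eqxx orbT big1 ?addr0 // => v va.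
  by rewrite !xpair_eqE /= [a == v]eq_sym (negPf va) (negPf ne).
rewrite big1 // => v _.
by rewrite !xpair_eqE [a == u]eq_sym [b == u]eq_sym (negPf ua) (negPf ub) andbF.
Qed.

Lemma degreeE G u : deg G u = \sum_(e | incident u e) (G e)%:R.
Proof.
rewrite -sum_incident; apply: eq_bigr => v _; rewrite mxE adjacentE.
by case: insub.
Qed.

Lemma expect_edge e : expectation (fun G => (G e)%:R) = p e.
Proof.
rewrite (@expect_eq _ _ _ B S _ (fun G => \prod_e'
   (fun e' (b : bool) => if e' == e then b%:R else 1) e' (G e'))); last first.
  by move=> G; rewrite (bigD1 e) //= eqxx big1 ?mulr1 // => e' /negPf ->.
rewrite (expect_prod B S (fun e' (b : bool) => if e' == e then b%:R else 1)).
rewrite (bigD1 e) //= eqxx big1 => [|e' /negPf ->]; by rewrite -/(p _); ring.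
Qed.

Lemma mean_degreeE u : mean_degree B S u = \sum_(e | incident u e) p e.
Proof.
rewrite /mean_degree (@expect_eq _ _ _ B S _ _ (fun G => degreeE G u)).
by rewrite expect_sum; apply: eq_bigr => e _; rewrite expect_edge.
Qed.

Lemma expect_adj u v :
  expectation (fun G => Defs.adj_mx R G u v) = oapp p 0 (insub (edge u v)).
Proof.
rewrite (@expect_eq _ _ _ B S _ (fun G => (oapp G false (insub (edge u v)))%:R)).
  by case: insub => [e|] /=; rewrite ?expect_edge ?expect_const.
by move=> G; rewrite mxE adjacentE.
Qed.

Hypothesis p01 : forall e, 0 <= p e <= 1.

Lemma expect_degree_variance u :
  expectation (fun G => (deg G u - mean_degree B S u) ^+ 2) <= mean_degree B S u.
Proof.
pose c (_ : vpair n) : R := 1.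
have cE G : (deg G u - mean_degree B S u) ^+ 2 = \sum_(e | incident u e)
    \sum_(e' | incident u e') centered_edge B S c G e * centered_edge B S c G e'.
  rewrite expr2 degreeE mean_degreeE -sumrB big_distrlr /=.
  by apply: eq_bigr => e _; apply: eq_bigr => e' _; rewrite /centered_edge !mul1r.
rewrite (expect_eq B S cE) expect_sum mean_degreeE; apply: ler_sum => e ue.
rewrite expect_sum (bigD1 e) //= big1 ?addr0 => [|e' /andP[_ ee']].
  rewrite (@expect_eq _ _ _ B S _ (fun G => \prod_e'
   (fun e' (b : bool) => if e' == e then (b%:R - p e) ^+ 2 else 1) e' (G e'))).
    rewrite (expect_prod B S (fun e' (b : bool) =>
      if e' == e then (b%:R - p e) ^+ 2 else 1)).
    rewrite (bigD1 e) //= eqxx big1 => [|e' /negPf ->]; last by rewrite -/(p _); ring.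
    move: (p01 e); rewrite -/(p e); move: (p e) => P; nra.
  move=> G; rewrite (bigD1 e) //= eqxx big1 ?mulr1 => [|e' /negPf -> //].
  by rewrite /centered_edge !mul1r expr2.
(* The covariance of two distinct edges vanishes, since each of them occurs once in the list
   [[:: e; e']]. *)
have := @expect_centered _ _ _ B S c 1 p01 _ _ [:: e; e'].
case: ifPn => [/forallP/(_ e)|_].
  by rewrite /= eqxx (negPf ee').
move=> h; apply/eqP; rewrite -normr_le0.
rewrite (@expect_eq _ _ _ B S _ (fun G => \prod_(e0 <- [:: e; e']) centered_edge B S c G e0)).
  apply: h => e0; first by rewrite normr1.
  by rewrite expr1n mul1r; case/andP: (p01 e0).
by move=> G; rewrite big_cons big_seq1.
Qed.

(* Chernoff's bound with the moment generating function evaluated at [-1] *)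
Lemma graph_prob_degree_small u :
  graph_prob (fun G => deg G u <= mean_degree B S u / 4)
  <= expR (- (mean_degree B S u / 4)).
Proof.
set d := mean_degree B S u.
have mgf : expectation (fun G => expR (- deg G u)) <= expR (- (d / 2)).
  pose F e (b : bool) : R := if incident u e && b then expR (-1) else 1.
  rewrite (@expect_eq _ _ _ B S _ (fun G => \prod_e F e (G e))); last first.
    move=> G; rewrite degreeE -sumrN expR_sum big_mkcond; apply: eq_bigr => e _.
    by rewrite /F; case: incident => //=; case: (G e); rewrite ?oppr0 ?expR0.
  rewrite expect_prod /d mean_degreeE mulr_suml -sumrN expR_sum.
  rewrite [leRHS]big_mkcond; apply: ler_prod => e _; rewrite /F -/(p e).
  have /andP[p0 p1] := p01 e; move: (p e) p0 p1 => P p0 p1.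
  case: incident => /=; last by apply/andP; split; lra.
  (* With e^(-1) <= 1/2, each factor is at most [1 - P / 2 <= expR (- (P / 2))]. *)
  have e2 : expR (-1) <= 2^-1 :> R.
    rewrite expRN lef_pV2 ?posrE ?expR_gt0 //.
    by have := expR_ge1Dx (1 : R); lra.
  have e0 : 0 < expR (-1) :> R := expR_gt0 _.
  have := expR_ge1Dx (- (P / 2)); move: (expR (-1)) e2 e0 => x x2 x0 h.
  by apply/andP; split; nra.
apply: (@le_trans _ _ (graph_prob (fun G => expR (- (d / 4)) <= expR (- deg G u)))).
  by apply: graph_prob_le => // G; rewrite ler_expR lerN2.
apply: le_trans (markov_graph p01 (expR_gt0 _) (fun G => expR_ge0 _)) _.
rewrite ler_pdivrMr ?expR_gt0 // -expRD; apply: le_trans mgf _.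
by rewrite ler_expR; lra.
Qed.

End Degrees.

Lemma oapp_edge (R : realType) (n : nat) (F : 'I_n -> 'I_n -> R) u v :
  (forall u v, F u v = F v u) ->
  oapp (fun e : vpair n => F (val e).1 (val e).2) 0 (insub (edge u v))
  = if u == v then 0 else F u v.
Proof.
move=> Fsym; pose F' (e : vpair n) := F (val e).1 (val e).2.
have ltE (a b : 'I_n) : (a < b)%N -> oapp F' 0 (insub (edge a b)) = F a b.
  by move=> ab; rewrite edge_val // insubT.
have [uv|vu|/val_inj ->] := ltngtP u v.
- by rewrite ltE // -val_eqE /= ltn_eqF.
- by rewrite edgeC ltE // -val_eqE /= gtn_eqF // Fsym.
- by rewrite eqxx insubF // /edge leqnn /= ltnn.
Qed.

(** * Operator bounds in a single model *)

Section DegreeEstimates.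
Context {R : realType} {K n : nat}.
Variables (B : 'M[R]_K) (S : dcsbm R K n.+1) (Mbar : 'I_K -> R).
Variables (mu beta rho xi D1 : R).
Implicit Types (G : graph n.+1) (e : vpair n.+1) (u v : 'I_n.+1).

Local Notation p := (vpair_prob B S).
Local Notation w := (weight S).
Local Notation d := (mean_degree B S).
Local Notation T := (total_weight S).
Local Notation Dbar := (mean_weight S).

Hypothesis B_sym : forall i j, B i j = B j i.
Hypothesis B_ge0 : forall i j, 0 <= B i j.
Hypothesis B_le : forall i j, B i j <= beta.
Hypothesis mu_gt0 : 0 < mu.
Hypothesis Mbar_ge : forall i, mu <= Mbar i.
Hypothesis D1_gt0 : 0 < D1.
Hypothesis w_ge : forall u, D1 <= w u.
Hypothesis p_le1 : forall u v, edge_prob B S u v <= 1.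
Hypothesis Msum_close : forall i, `|Msum B S i / T - Mbar i| <= rho.
Hypothesis xi_ge : rho + D1^-1 <= xi.
Hypothesis xi_le : xi <= mu / 2.

Lemma weight_pos u : 0 < w u.
Proof. exact: lt_le_trans (w_ge u). Qed.

Lemma total_weight_gt0 : 0 < T.
Proof.
rewrite /total_weight (bigD1 ord0) //= ltr_wpDr ?weight_pos //.
by apply: sumr_ge0 => u _; exact/ltW/weight_pos.
Qed.

Lemma mean_weight_total : n.+1%:R * Dbar = T.
Proof. by rewrite /mean_weight mulVKf // pnatr_eq0. Qed.

Lemma mean_weight_gt0 : 0 < Dbar.
Proof. by rewrite /mean_weight mulr_gt0 ?total_weight_gt0 // invr_gt0 ltr0n. Qed.

Lemma edge_probE u v :
  edge_prob B S u v = w u * w v / T * B (label S u) (label S v).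
Proof. by rewrite /edge_prob mean_weight_total. Qed.

Lemma edge_prob_ge0 u v : 0 <= edge_prob B S u v.
Proof.
by rewrite edge_probE mulr_ge0 // divr_ge0 ?mulr_ge0 ?ltW ?weight_pos ?total_weight_gt0.
Qed.

Lemma edge_prob_le u v : edge_prob B S u v <= w u * w v / T * beta.
Proof.
rewrite edge_probE ler_wpM2l // divr_ge0 ?mulr_ge0 ?ltW ?weight_pos //.
exact: total_weight_gt0.
Qed.

Lemma edge_probC u v : edge_prob B S u v = edge_prob B S v u.
Proof. by rewrite !edge_probE B_sym [w u * _]mulrC. Qed.

Lemma vpair_prob01 e : 0 <= p e <= 1.
Proof. by rewrite /vpair_prob edge_prob_ge0 p_le1. Qed.

Lemma vpair_prob_edge u v :
  oapp p 0 (insub (edge u v)) = if u == v then 0 else edge_prob B S u v.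
Proof.
exact: (oapp_edge _ _ edge_probC).
Qed.

Lemma mean_degree_Msum u :
  d u = w u * (Msum B S (label S u) / T) - edge_prob B S u u.
Proof.
have -> : w u * (Msum B S (label S u) / T) = \sum_v edge_prob B S u v.
  rewrite /Msum mulr_suml mulr_sumr; apply: eq_bigr => v _.
  by rewrite edge_probE; ring.
rewrite mean_degreeE -sum_incident (bigD1 u) //= vpair_prob_edge eqxx add0r.
rewrite [in RHS](bigD1 u) //= [RHS]addrAC subrr add0r.
by apply: eq_bigr => v vu; rewrite vpair_prob_edge eq_sym (negPf vu).
Qed.

(** Besides the error [rho], the absence of loops costs the term [edge_prob B S u u]. It is at most
    1, hence at most [D1^-1] after division by the weight; this explains the bound required of
    [xi]. *)
Lemma mean_degree_close u : `|d u / w u - Mbar (label S u)| <= xi.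
Proof.
have wu := weight_pos u; have := xi_ge; apply: le_trans.
have -> : d u / w u - Mbar (label S u) =
    (Msum B S (label S u) / T - Mbar (label S u)) - edge_prob B S u u / w u.
  by rewrite mean_degree_Msum; field; rewrite !gt_eqF ?total_weight_gt0.
apply: le_trans (ler_normB _ _) _; apply: lerD => //.
rewrite ger0_norm ?divr_ge0 ?edge_prob_ge0 ?(ltW wu) //.
rewrite ler_pdivrMr // (le_trans (p_le1 u u)) //.
by rewrite -(ler_pM2l D1_gt0) mulr1 mulrA divff ?gt_eqF // mul1r.
Qed.

Lemma mean_degree_ratio u : mu / 2 <= d u / w u.
Proof.
have := mean_degree_close u; rewrite ler_distl => /andP[+ _].
by move: (Mbar_ge (label S u)) xi_le; lra.
Qed.

Lemma mean_degree_ge u : w u * (mu / 2) <= d u.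
Proof. by rewrite mulrC -ler_pdivlMr ?weight_pos ?mean_degree_ratio. Qed.

Lemma mean_degree_gt0 u : 0 < d u.
Proof.
by apply: lt_le_trans (mean_degree_ge u); rewrite mulr_gt0 ?weight_pos ?divr_gt0.
Qed.

Lemma mean_degree_geD1 u : D1 * (mu / 2) <= d u.
Proof.
by apply: le_trans (mean_degree_ge u); rewrite ler_wpM2r ?w_ge // divr_ge0 // ltW.
Qed.

Lemma EH_mxE u v :
  EH_mx B S u v = (d u * d v)^-1 * (if u == v then 0 else edge_prob B S u v).
Proof.
rewrite mxE (@expect_eq _ _ _ B S _ (fun G => (d u * d v)^-1 * adj_mx R G u v)).
  by rewrite expectZ expect_adj vpair_prob_edge.
by move=> G; rewrite mxE.
Qed.

(** The weights cancel: off the diagonal EH is P with the ratio of mean degree to weight in place of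
    [Mbar]. *)
Lemma EH_mx_ratio u v : EH_mx B S u v = if u == v then 0 else
  T^-1 * (B (label S u) (label S v) / ((d u / w u) * (d v / w v))).
Proof.
rewrite EH_mxE; case: eqP => _; first by rewrite mulr0.
rewrite edge_probE; field.
by rewrite !gt_eqF ?mean_degree_gt0 ?weight_pos ?total_weight_gt0.
Qed.

Lemma EH_mx_ge0 u v : 0 <= EH_mx B S u v.
Proof.
rewrite EH_mxE; case: eqP => _; first by rewrite mulr0.
have d0 u' : 0 <= d u' by exact/ltW/mean_degree_gt0.
apply: mulr_ge0; last exact: edge_prob_ge0.
by rewrite invr_ge0 mulr_ge0.
Qed.

Lemma EH_mx_le u v : EH_mx B S u v <= 4 * beta / mu ^+ 2 / T.
Proof.
have beta0 : 0 <= beta := le_trans (B_ge0 (label S u) (label S v)) (B_le _ _).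
have T0 := total_weight_gt0; have m0 := mu_gt0.
rewrite EH_mx_ratio; case: eqP => _.
  apply: divr_ge0; last exact: ltW.
  by apply: divr_ge0; [exact: mulr_ge0|exact: sqr_ge0].
rewrite mulrC ler_pM2r ?invr_gt0 //.
have au := mean_degree_ratio u; have av := mean_degree_ratio v.
have a0 : 0 < mu / 2 by rewrite divr_gt0.
move: (d u / w u) (d v / w v) au av => a b au av.
have a1 : 0 < a := lt_le_trans a0 au; have b1 : 0 < b := lt_le_trans a0 av.
have ab0 : 0 < a * b by rewrite mulr_gt0.
have h : (a * b)^-1 <= 4 / mu ^+ 2.
  have -> : 4 / mu ^+ 2 = (mu / 2 * (mu / 2))^-1 by field; rewrite gt_eqF.
  rewrite lef_pV2 ?posrE ?mulr_gt0 //.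
  by apply: ler_pM; rewrite ?(ltW a0).
rewrite [4 * beta]mulrC -[leRHS]mulrA; apply: ler_pM => //.
by rewrite invr_ge0 ltW.
Qed.

Lemma EH_P_offdiag u v : u != v ->
  `|EH_mx B S u v - P_mx B S Mbar u v| <= 6 * beta * xi / mu ^+ 3 / T.
Proof.
move=> uv; rewrite EH_mx_ratio (negPf uv) mxE mean_weight_total -mulrBr normrM.
have Ti : 0 < T^-1 by rewrite invr_gt0 total_weight_gt0.
rewrite (ger0_norm (ltW Ti)) [leRHS]mulrC ler_pM2l //.
have bl := B_le (label S u) (label S v); have b0 := B_ge0 (label S u) (label S v).
have m0 := mu_gt0; have mu2 : 0 < mu / 2 by rewrite divr_gt0.
have := mean_degree_ratio u; have := mean_degree_ratio v.
have := mean_degree_close u; have := mean_degree_close v.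
have := Mbar_ge (label S u); have := Mbar_ge (label S v).
move: (d u / w u) (d v / w v) (Mbar (label S u)) (Mbar (label S v)).
move: (B _ _) bl b0 => b bl b0 x y x' y' hy' hx' cy cx hy hx.
have x0 : 0 < x := lt_le_trans mu2 hx; have y0 : 0 < y := lt_le_trans mu2 hy.
have x'0 : 0 < x' := lt_le_trans m0 hx'; have y'0 : 0 < y' := lt_le_trans m0 hy'.
(* One ratio is replaced at a time. With [x] and [y] at least [mu / 2], and [x'] and [y'] at least
   [mu], the two terms cost 4 and 2, whence the factor 6. *)
have -> : b / (x * y) - b / (x' * y') =
    b * ((x' - x) / x / x' / y + (y' - y) / y / y' / x').
  by field; rewrite !gt_eqF.
have inv (a c : R) : 0 < a -> a <= c -> c^-1 <= a^-1.
  by move=> a0 ac; rewrite lef_pV2 ?posrE // (lt_le_trans a0).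
have ix := inv _ _ mu2 hx; have iy := inv _ _ mu2 hy.
have ix' := inv _ _ m0 hx'; have iy' := inv _ _ m0 hy'.
have xi0 : 0 <= xi := le_trans (normr_ge0 _) cx.
rewrite normrM (ger0_norm b0).
have h1 : `|(x' - x) / x / x' / y| <= xi * (mu / 2)^-1 * mu^-1 * (mu / 2)^-1.
  rewrite !normrM !normfV (gtr0_norm x0) (gtr0_norm x'0) (gtr0_norm y0).
  have i0 : 0 <= x^-1 /\ 0 <= x'^-1 /\ 0 <= y^-1 by rewrite !invr_ge0 !ltW.
  case: i0 => i1 [i2 i3]; rewrite distrC.
  by do 3![apply: ler_pM; rewrite ?mulr_ge0 //].
have h2 : `|(y' - y) / y / y' / x'| <= xi * (mu / 2)^-1 * mu^-1 * mu^-1.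
  rewrite !normrM !normfV (gtr0_norm y0) (gtr0_norm x'0) (gtr0_norm y'0).
  have i0 : 0 <= y^-1 /\ 0 <= x'^-1 /\ 0 <= y'^-1 by rewrite !invr_ge0 !ltW.
  case: i0 => i1 [i2 i3]; rewrite distrC.
  by do 3![apply: ler_pM; rewrite ?mulr_ge0 //].
have -> : 6 * beta * xi / mu ^+ 3 = beta * (xi * (mu / 2)^-1 * mu^-1 * (mu / 2)^-1
   + xi * (mu / 2)^-1 * mu^-1 * mu^-1) by field; rewrite gt_eqF.
apply: ler_pM => //.
exact: le_trans (ler_normD _ _) (lerD h1 h2).
Qed.

Lemma EH_P_diag u :
  `|EH_mx B S u u - P_mx B S Mbar u u| <= beta / mu ^+ 2 / T.
Proof.
rewrite EH_mx_ratio eqxx mxE mean_weight_total sub0r normrN.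
have Ti : 0 < T^-1 by rewrite invr_gt0 total_weight_gt0.
have m0 := mu_gt0; have Mu := Mbar_ge (label S u).
have M0 : 0 < Mbar (label S u) := lt_le_trans m0 Mu.
have M2 : 0 <= (Mbar (label S u) * Mbar (label S u))^-1.
  by rewrite invr_ge0 mulr_ge0 // ltW.
rewrite ger0_norm; last by rewrite mulr_ge0 ?(ltW Ti) // mulr_ge0.
rewrite [leRHS]mulrC ler_pM2l //; apply: ler_pM => //.
rewrite lef_pV2 ?posrE ?exprn_gt0 ?mulr_gt0 // expr2.
by apply: ler_pM => //; exact: ltW.
Qed.

(** Off the diagonal every entry is O(xi / T), and T = n Dbar turns this into O(xi / Dbar). On the
    diagonal EH vanishes and P need not, so no factor [xi] is available there; the Frobenius norm of
    a diagonal matrix gains [1 / sqrt n] instead. *)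
Lemma op_bounded_EH_P : op_bounded (EH_mx B S - P_mx B S Mbar)
  ((6 * beta * xi / mu ^+ 3 + beta / mu ^+ 2 / Num.sqrt n.+1%:R) / Dbar).
Proof.
have T0 := total_weight_gt0; have D0 := mean_weight_gt0; have m0 := mu_gt0.
have beta0 : 0 <= beta := le_trans (B_ge0 (label S ord0) (label S ord0)) (B_le _ _).
have xi0 : 0 <= xi := le_trans (normr_ge0 _) (mean_degree_close ord0).
have sn0 : 0 < Num.sqrt n.+1%:R :> R by rewrite sqrtr_gt0 ltr0n.
have sn2 : Num.sqrt n.+1%:R ^+ 2 = n.+1%:R :> R by rewrite sqr_sqrtr.
set X := EH_mx B S - P_mx B S Mbar.
pose X1 : 'M[R]_n.+1 := \matrix_(u, v) if u == v then 0 else X u v.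
pose X2 : 'M[R]_n.+1 := \matrix_(u, v) if u == v then X u v else 0.
have -> : X = X1 + X2.
  by apply/matrixP => u v; rewrite !mxE; case: eqP; rewrite ?add0r ?addr0.
rewrite mulrDl; apply: op_boundedD.
  pose a := 6 * beta * xi / mu ^+ 3 / T.
  have a0 : 0 <= a.
    apply: divr_ge0; last exact: ltW.
    by apply: divr_ge0; [rewrite !mulr_ge0|rewrite exprn_ge0 // ltW].
  have := @op_bounded_outer _ _ X1 (fun=> a) (fun=> 1).
  have -> : Num.sqrt (\sum_(u < n.+1) a ^+ 2) * Num.sqrt (\sum_(u < n.+1) 1 ^+ 2) =
      6 * beta * xi / mu ^+ 3 / Dbar.
    rewrite !sumr_const card_ord -[a ^+ 2 *+ _]mulr_natr expr1n.
    rewrite sqrtrM ?sqr_ge0 // sqrtr_sqr ger0_norm // -mulrA -expr2 sn2.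
    rewrite /a -mean_weight_total; field.
    by rewrite ?nat1r !gt_eqF ?D0 ?m0 ?ltr0n.
  apply => // u v; rewrite mulr1 mxE; case: eqP => [_|/eqP uv].
    by rewrite normr0.
  by have := EH_P_offdiag uv; rewrite !mxE.
apply: op_bounded_le (op_bounded_frobenius X2).
have -> : beta / mu ^+ 2 / Num.sqrt n.+1%:R / Dbar =
    Num.sqrt (\sum_(u < n.+1) (beta / mu ^+ 2 / T) ^+ 2).
  rewrite sumr_const card_ord -[_ ^+ 2 *+ _]mulr_natr sqrtrM ?sqr_ge0 // sqrtr_sqr.
  rewrite ger0_norm; last first.
    by apply: divr_ge0; [apply: divr_ge0 => //; rewrite exprn_ge0 // ltW|exact: ltW].
  rewrite -mean_weight_total; move: (Num.sqrt _) sn0 sn2 => sn sn0 <-; field.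
  by rewrite !gt_eqF.
apply: ler_wsqrtr; apply: ler_sum => u _.
rewrite (bigD1 u) //= big1 ?addr0; last first.
  by move=> v vu; rewrite mxE eq_sym (negPf vu) expr0n.
rewrite mxE eqxx -(real_normK (num_real _)) lerXn2r ?nnegrE ?normr_ge0 //.
  by apply: divr_ge0; [apply: divr_ge0 => //; rewrite exprn_ge0 // ltW|exact: ltW].
by have := EH_P_diag u; rewrite !mxE.
Qed.

Lemma W_mx_bounded G eta1 eta3 : 0 <= eta1 -> 0 <= eta3 ->
  op_bounded (H_mx B S G - EH_mx B S) (eta1 / Dbar) ->
  (forall u, d u / 4 <= Defs.degree R G u) ->
  \sum_u ((Defs.degree R G u - d u) / d u) ^+ 2 <= eta3 * n.+1%:R ->
  op_bounded (W_mx B S Mbar G)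
    ((16 * eta1 + 80 * beta / mu ^+ 2 * Num.sqrt eta3
      + (6 * beta * xi / mu ^+ 3 + beta / mu ^+ 2 / Num.sqrt n.+1%:R)) / Dbar).
Proof.
move=> eta1_0 eta3_0 HEH deg_ge sum_le.
have T0 := total_weight_gt0; have D0 := mean_weight_gt0; have m0 := mu_gt0.
have beta0 : 0 <= beta := le_trans (B_ge0 (label S ord0) (label S ord0)) (B_le _ _).
have d0 := mean_degree_gt0.
have deg0 u : 0 < Defs.degree R G u.
  by apply: lt_le_trans (deg_ge u); rewrite divr_gt0.
pose e u := d u / Defs.degree R G u; pose f u := e u - 1.
have e0 u : 0 <= e u by rewrite /e divr_ge0 // ltW.
have e4 u : e u <= 4 by rewrite /e ler_pdivrMr //; have := deg_ge u; lra.
have fle u : `|f u| <= 4 * `|(Defs.degree R G u - d u) / d u|.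
  have -> : f u = - (e u * ((Defs.degree R G u - d u) / d u)).
    by rewrite /f /e; field; rewrite !gt_eqF.
  by rewrite normrN normrM ler_wpM2r // ger0_norm.
pose X1 := \matrix_(u, v) (e u * e v * (H_mx B S G - EH_mx B S) u v).
(* The splitting e_u e_v - 1 = f_u e_v + f_v gives two matrices whose entries are dominated by a
   function of [u] times a function of [v], as [op_bounded_outer] requires. *)
pose X2 : 'M[R]_n.+1 := \matrix_(u, v) (f u * (e v * EH_mx B S u v)).
pose X3 : 'M[R]_n.+1 := \matrix_(u, v) (f v * EH_mx B S u v).
have -> : W_mx B S Mbar G = X1 + (X2 + X3) + (EH_mx B S - P_mx B S Mbar).
  apply/matrixP => u v; rewrite !mxE.
  have -> : (if Defs.adjacent G u v then
      (Defs.degree R G u * Defs.degree R G v)^-1 else 0) =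
      e u * e v * ((d u * d v)^-1 * (Defs.adjacent G u v)%:R).
    rewrite /e; case: (Defs.adjacent G u v); rewrite ?mulr0 // mulr1.
    by field; rewrite !gt_eqF.
  by rewrite /f; ring.
rewrite mulrDl mulrDl; apply: op_boundedD; last exact: op_bounded_EH_P.
apply: op_boundedD.
  have := @op_bounded_scale _ _ _ _ e 4 (divr_ge0 eta1_0 (ltW D0)) ltac:(lra) _ HEH.
  have -> : 4 ^+ 2 * (eta1 / Dbar) = 16 * eta1 / Dbar by ring.
  by apply=> u; rewrite ger0_norm.
set A := 4 * beta / mu ^+ 2 / T.
have A0 : 0 <= A.
  apply: divr_ge0; last exact: ltW.
  by apply: divr_ge0; [exact: mulr_ge0|rewrite exprn_ge0 // ltW].
have EHA u v : `|EH_mx B S u v| <= A by rewrite ger0_norm ?EH_mx_ge0 ?EH_mx_le.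
have sf : Num.sqrt (\sum_u `|f u| ^+ 2) <= 4 * Num.sqrt eta3 * Num.sqrt n.+1%:R.
  have -> : 4 * Num.sqrt eta3 * Num.sqrt n.+1%:R = Num.sqrt (4 ^+ 2 * (eta3 * n.+1%:R)).
    by rewrite sqrtrM ?sqr_ge0 // sqrtr_sqr ger0_norm // sqrtrM // mulrA.
  apply: ler_wsqrtr; apply: le_trans (ler_wpM2l _ sum_le) => //.
  rewrite mulr_sumr; apply: ler_sum => u _.
  rewrite -[X in _ <= _ * X](real_normK (num_real _)) -exprMn.
  by rewrite lerXn2r ?nnegrE ?mulr_ge0.
have sn2 : Num.sqrt n.+1%:R * Num.sqrt n.+1%:R = n.+1%:R :> R.
  by rewrite -expr2 sqr_sqrtr.
have sc (a : R) : 0 <= a -> Num.sqrt (\sum_(u < n.+1) a ^+ 2) = Num.sqrt n.+1%:R * a.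
  move=> a0; rewrite sumr_const card_ord -[a ^+ 2 *+ _]mulr_natl sqrtrM //.
  by rewrite sqrtr_sqr ger0_norm.
have AE : A * n.+1%:R = 4 * beta / mu ^+ 2 / Dbar.
  rewrite /A -mean_weight_total; field.
  by rewrite ?nat1r !gt_eqF ?D0 ?m0 ?ltr0n.
(* 80 = 64 + 16: both terms carry 4 from [fle] and 4 from [A], and [X2] another 4 from
   [e v <= 4]. *)
have -> : 80 * beta / mu ^+ 2 * Num.sqrt eta3 / Dbar =
    4 * Num.sqrt eta3 * 4 * (A * n.+1%:R) + 4 * Num.sqrt eta3 * (A * n.+1%:R).
  by rewrite AE; ring.
apply: op_boundedD.
  apply: (@op_bounded_le _ _ _ (Num.sqrt (\sum_u `|f u| ^+ 2) *
      Num.sqrt (\sum_(u < n.+1) (4 * A) ^+ 2))).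
    rewrite sc; last exact: mulr_ge0.
    apply: le_trans (ler_wpM2r _ sf) _.
      by apply: mulr_ge0; [exact: sqrtr_ge0|exact: mulr_ge0].
    by rewrite le_eqVlt; apply/orP; left; apply/eqP;
      move: (Num.sqrt n.+1%:R) sn2 => sn <-; ring.
  refine (@op_bounded_outer R n.+1 X2 (fun u => `|f u|) (fun=> 4 * A) _ _ _) => [u v|u|u] //.
    rewrite mxE normrM ler_wpM2l // normrM ger0_norm //.
    by apply: ler_pM.
  by rewrite mulr_ge0.
apply: (@op_bounded_le _ _ _ (Num.sqrt (\sum_(u < n.+1) A ^+ 2) *
    Num.sqrt (\sum_u `|f u| ^+ 2))).
  rewrite sc // mulrC; apply: le_trans (ler_wpM2r _ sf) _.
    by apply: mulr_ge0; [exact: sqrtr_ge0|].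
  by rewrite le_eqVlt; apply/orP; left; apply/eqP;
      move: (Num.sqrt n.+1%:R) sn2 => sn <-; ring.
refine (@op_bounded_outer R n.+1 X3 (fun=> A) (fun u => `|f u|) _ _ _) => [u v|u|u] //.
by rewrite mxE normrM mulrC ler_wpM2r.
Qed.

Lemma graph_prob_some_degree_small :
  graph_prob B S (fun G => ~ forall u, d u / 4 <= Defs.degree R G u) <=
  n.+1%:R * expR (- (D1 * mu / 8)).
Proof.
apply: (@le_trans _ _ (graph_prob B S
    (fun G => exists u, Defs.degree R G u <= d u / 4))).
  apply: graph_prob_le; first exact: vpair_prob01.
  move=> G nall; apply: contrapT => nex; apply: nall => u.
  by case: (leP (d u / 4) (Defs.degree R G u)) => // /ltW h; case: nex; exists u.
apply: le_trans (graph_prob_ex vpair_prob01 _) _.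
apply: (@le_trans _ _ (\sum_(u < n.+1) expR (- (D1 * mu / 8)))).
  apply: ler_sum => u _; apply: le_trans (graph_prob_degree_small vpair_prob01 u) _.
  by rewrite ler_expR lerN2; have := mean_degree_geD1 u; lra.
by rewrite sumr_const card_ord mulr_natl.
Qed.

Lemma graph_prob_degree_variance eta3 : 0 < eta3 ->
  graph_prob B S (fun G => eta3 * n.+1%:R <=
    \sum_u ((Defs.degree R G u - d u) / d u) ^+ 2) <= 2 / (mu * D1 * eta3).
Proof.
move=> eta0; have m0 := mu_gt0; have D0 := D1_gt0.
have N0 : 0 < n.+1%:R :> R by rewrite ltr0n.
apply: le_trans (markov_graph vpair_prob01 _ _) _.
- by rewrite mulr_gt0.
- by move=> G; apply: sumr_ge0 => u _; exact: sqr_ge0.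
rewrite ler_pdivrMr ?mulr_gt0 //.
have -> : 2 / (mu * D1 * eta3) * (eta3 * n.+1%:R) = \sum_(u < n.+1) (D1 * (mu / 2))^-1.
  rewrite sumr_const card_ord -[_ *+ n.+1]mulr_natr; field.
  by rewrite !gt_eqF.
rewrite expect_sum; apply: ler_sum => u _; have du := mean_degree_gt0 u.
rewrite (@expect_eq _ _ _ B S _
    (fun G => (d u ^+ 2)^-1 * (Defs.degree R G u - d u) ^+ 2)); last first.
  by move=> G; rewrite expr_div_n mulrC.
rewrite expectZ mulrC ler_pdivrMr ?exprn_gt0 //.
apply: le_trans (expect_degree_variance vpair_prob01 u) _.
rewrite mulrC ler_pdivlMr ?mulr_gt0 ?divr_gt0 // expr2 ler_pM2l //.
exact: mean_degree_geD1.
Qed.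

(** H - EH is [b] times a centered matrix. The lower bound on [b] makes the coefficients at most 1,
    the lower bound on [tau] controls the variances, and the trace method applies. *)
Lemma graph_prob_H_EH (b tau r t : R) (q : nat) : 0 < b ->
  4 / (mu ^+ 2 * D1 ^+ 2) <= b ->
  16 * beta / (mu ^+ 4 * D1 ^+ 2 * T * b ^+ 2) <= tau -> tau <= 1 -> 2 <= r ->
  tau * n.+1%:R + 8 * q%:R <= r -> (0 < q)%N -> 0 < t ->
  graph_prob B S (fun G => ~ op_bounded (H_mx B S G - EH_mx B S) (b * t)) <=
  n.+1%:R * (2 * r) ^+ (2 * q) * Num.sqrt (2 / r) ^+ q / t ^+ (2 * q).
Proof.
move=> b0 hb htau tau1 r2 hr q0 t0.
have T0 := total_weight_gt0; have D0 := mean_weight_gt0; have m0 := mu_gt0.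
have D10 := D1_gt0; have d0 := mean_degree_gt0.
have beta0 : 0 <= beta := le_trans (B_ge0 (label S ord0) (label S ord0)) (B_le _ _).
have tau0 : 0 <= tau.
  apply: le_trans htau; apply: divr_ge0; first exact: mulr_ge0.
  by rewrite !mulr_ge0 ?exprn_ge0 ?ltW.
have ddge u v : D1 ^+ 2 * (mu ^+ 2 / 4) <= d u * d v.
  have -> : D1 ^+ 2 * (mu ^+ 2 / 4) = D1 * (mu / 2) * (D1 * (mu / 2)) by field.
  have h : 0 <= D1 * (mu / 2) by rewrite mulr_ge0 ?divr_ge0 ?ltW.
  by apply: ler_pM => //; exact: mean_degree_geD1.
have ddgew u v : w u * w v * (mu ^+ 2 / 4) <= d u * d v.
  have -> : w u * w v * (mu ^+ 2 / 4) = w u * (mu / 2) * (w v * (mu / 2)) by field.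
  have h u' : 0 <= w u' * (mu / 2) by rewrite mulr_ge0 ?divr_ge0 ?ltW ?weight_pos.
  by apply: ler_pM => //; exact: mean_degree_ge.
pose c (e : vpair n.+1) := (b * (d (val e).1 * d (val e).2))^-1.
have c1 e : `|c e| <= 1.
  have bdd : 0 < b * (d (val e).1 * d (val e).2) by rewrite !mulr_gt0.
  rewrite /c normfV gtr0_norm // invf_le1 //.
  apply: le_trans (ler_pM _ _ hb (ddge _ _)); last 2 first.
  - by rewrite divr_ge0 // mulr_ge0 ?exprn_ge0 ?ltW.
  - by rewrite mulr_ge0 ?exprn_ge0 ?divr_ge0 ?exprn_ge0 ?ltW.
  by rewrite le_eqVlt; apply/orP; left; apply/eqP; field; rewrite !gt_eqF.
have c2 e : c e ^+ 2 * vpair_prob B S e <= tau.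
  apply: le_trans htau; rewrite /c /vpair_prob.
  have := edge_prob_le (val e).1 (val e).2; have := edge_prob_ge0 (val e).1 (val e).2.
  have := ddge (val e).1 (val e).2; have := ddgew (val e).1 (val e).2.
  have : 0 < d (val e).1 * d (val e).2 by rewrite mulr_gt0.
  move: (d _ * d _) => dd; have := weight_pos (val e).1; have := weight_pos (val e).2.
  move: (w _) (w _) (edge_prob _ _ _ _) => x y P x0 y0 dd0 hw hD P0 hP.
  rewrite exprVn mulrC ler_pdivrMr ?exprn_gt0 ?mulr_gt0 //.
  apply: (le_trans hP).
  (* One of the two factors [dd] is bounded below through the weights, which cancels those of the
     edge probability, and the other through [D1]. *)
  have h : (x * y * (mu ^+ 2 / 4)) * (D1 ^+ 2 * (mu ^+ 2 / 4)) <= dd ^+ 2.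
    rewrite expr2; apply: ler_pM => //; apply/ltW.
      by rewrite !mulr_gt0 ?invr_gt0 ?exprn_gt0.
    by rewrite !mulr_gt0 ?invr_gt0 ?exprn_gt0.
  have -> : x * y / T * beta =
    16 * beta / (mu ^+ 4 * D1 ^+ 2 * T * b ^+ 2) * (b ^+ 2 *
     ((x * y * (mu ^+ 2 / 4)) * (D1 ^+ 2 * (mu ^+ 2 / 4)))).
    by field; rewrite !gt_eqF.
  rewrite exprMn ler_wpM2l //; last by rewrite ler_wpM2l ?exprn_ge0 // ltW.
  apply: divr_ge0; first exact: mulr_ge0.
  by rewrite !mulr_ge0 ?exprn_ge0 ?ltW.
apply: le_trans (graph_prob_centered_mx vpair_prob01 tau0 tau1 r2 c1 c2 q0 t0 hr).
apply: graph_prob_le; first exact: vpair_prob01.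
move=> G nb Mt; apply: nb; rewrite -[H_mx B S G - _](_ : b *: centered_mx B S c G = _).
  by apply: op_boundedZ => //; exact: ltW.
apply/matrixP => u v; rewrite mxE [centered_mx _ _ _ _ _ _]mxE [RHS]mxE.
rewrite [(- EH_mx B S) u v]mxE [H_mx B S G u v]mxE [adj_mx R G u v]mxE EH_mxE.
have -> : centered_pair B S c G (edge u v) = if u == v then 0 else
    (b * (d u * d v))^-1 * ((Defs.adjacent G u v)%:R - edge_prob B S u v).
  rewrite -(@oapp_edge _ _ (fun u v => (b * (d u * d v))^-1 *
    ((Defs.adjacent G u v)%:R - edge_prob B S u v))).
    rewrite /centered_pair; case: insub => //= e.
    by rewrite /centered_edge adjacentE edge_vpair valK.
  by move=> u' v'; rewrite adjacentC edge_probC [d u' * _]mulrC.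
have [->|uv] := eqVneq u v.
  rewrite adjacentE insubF ?mulr0 ?subr0 //.
  by rewrite /edge leqnn /= ltnn.
by field; rewrite !gt_eqF.
Qed.

End DegreeEstimates.

(** * The spectral gap of P *)

Lemma seq_positive_lower_bound (R : realDomainType) (s : seq R) :
  (forall x, x \in s -> 0 < x) -> exists2 y, 0 < y & forall x, x \in s -> y <= x.
Proof.
elim: s => [_|a s IH sp]; first by exists 1.
have [|y y0 ys] := IH; first by move=> x xs; apply: sp; rewrite inE xs orbT.
exists (Num.min a y); first by rewrite lt_min sp ?mem_head.
by move=> x; rewrite inE ge_min => /predU1P[->|/ys ->]; rewrite ?lexx ?orbT.
Qed.

Lemma seq_separation (R : realType) (s : seq R[i]) :
  exists2 delta : R, 0 < delta &
    forall z w, z \in s -> w \in s -> z != w -> delta <= complex.Re `|z - w|.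
Proof.
have [|y y0 ys] := @seq_positive_lower_bound R
    [seq complex.Re `|p.1 - p.2| | p <- [seq p <- allpairs pair s s | p.1 != p.2]].
  move=> _ /mapP[p + ->]; rewrite mem_filter => /andP[p12 _].
  by rewrite Re_norm_gt0 // subr_eq0.
exists y => // z w zs ws zw; apply: ys; apply/mapP; exists (z, w) => //.
by rewrite mem_filter zw; apply/allpairsP; exists (z, w).
Qed.

Section PMatrix.
Context {R : realType} {K : nat}.
Variables (B : 'M[R]_K) (Mbar alpha : 'I_K -> R).

Hypothesis B_sym : forall i j, B i j = B j i.

Lemma P_mx_sym n (S : dcsbm R K n) : (P_mx B S Mbar)^T = P_mx B S Mbar.
Proof. by apply/matrixP => u v; rewrite !mxE B_sym [Mbar _ * _]mulrC. Qed.

(* Up to the factor [mean_weight S], the nonzero eigenvalues of [P_mx] are those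
   of a [K x K] matrix that does not depend on the model. *)
Definition community_mx : 'M[R[i]]_K :=
  \matrix_(i, j) (alpha j * (B i j / (Mbar i * Mbar j)))%:C%C.

(** An entry of P depends only on the labels, so a left eigenvector [v] matters through its sums [g]
    over the communities. These form an eigenvector, nonzero because [z *: v] is determined by [g]
    and [z != 0]. *)
Lemma spectrum_P_mx n (S : dcsbm R K n) z : 0 < mean_weight S ->
  (forall k, #|[set u | label S u == k]%SET|%:R = alpha k * n%:R) ->
  spectrum (P_mx B S Mbar) z -> z != 0 ->
  eigenvalue community_mx ((mean_weight S)%:C%C * z).
Proof.
move=> D0 card_label /eigenvalueP[v vP v0] z0.
have n0 : (0 < n)%N.
  rewrite lt0n; apply: contra_neq v0 => n0; apply/rowP => u.
  by have := ltn_ord u; rewrite {2}n0.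
pose g : 'rV[R[i]]_K := \row_i \sum_(u | label S u == i) v 0 u.
pose h j : R[i] := \sum_i g 0 i * ((n%:R * mean_weight S)^-1 *
    (B i j / (Mbar i * Mbar j)))%:C%C.
have vE u' : z * v 0 u' = h (label S u').
  have /rowP/(_ u') := vP; rewrite !mxE => <-.
  rewrite (partition_big (label S) predT) //=; apply: eq_bigr => i _.
  rewrite mxE mulr_suml; apply: eq_bigr => u /eqP lu.
  by rewrite !mxE lu.
have gE j : z * g 0 j = (alpha j * n%:R)%:C%C * h j.
  rewrite mxE mulr_sumr (eq_bigr (fun=> h j)) => [|u /eqP <-]; last exact: vE.
  rewrite sumr_const -card_label -[h j *+ _]mulr_natl rmorph_nat; congr (_%:R * _).
  by apply: eq_card => u; rewrite inE.
apply/eigenvalueP; exists g.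
  apply/rowP => j; rewrite [LHS]mxE [RHS]mxE -mulrA gE !mulr_sumr.
  apply: eq_bigr => i _; rewrite [community_mx i j]mxE.
  rewrite [in RHS](mulrCA _ (g 0 i)) [in RHS](mulrCA _ (g 0 i)) -!rmorphM /=.
  congr (_ * _%:C%C).
  by move: (B i j / _) => x; field; rewrite !gt_eqF ?ltr0n.
apply: contra v0 => /eqP g0; apply/eqP/rowP => u; rewrite mxE.
have : z * v 0 u = 0.
  by rewrite vE /h big1 // => i _; rewrite g0 mxE mul0r.
by move=> /eqP; rewrite mulf_eq0 (negPf z0) => /eqP.
Qed.

(** Two of the vertices share a label, and the difference of their unit vectors is in the kernel.
    The eigenvalue 0 serves as the second eigenvalue needed for a positive gap. *)
Lemma spectrum_P_mx_0 n (S : dcsbm R K n) : (K < n)%N ->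
  spectrum (P_mx B S Mbar) 0.
Proof.
move=> Kn; have : ~~ injectiveb (label S).
  apply/negP => /injectiveP/leq_card; rewrite !card_ord leqNgt; by rewrite Kn.
move=> /injectivePn[u [v uv luv]].
apply/eigenvalueP; exists (delta_mx 0 u - delta_mx 0 v).
  rewrite scale0r mulmxBl -!rowE; apply/rowP => w; rewrite !mxE luv.
  by rewrite subrr.
apply/eqP => /rowP/(_ u)/eqP; rewrite !mxE !eqxx (negPf uv) /= subr0.
by rewrite oner_eq0.
Qed.

Lemma P_mx_neq0 n (S : dcsbm R K n) u v : 0 < mean_weight S ->
  (forall i, 0 < Mbar i) -> B (label S u) (label S v) != 0 ->
  P_mx B S Mbar u v != 0.
Proof.
move=> D0 M0 Buv; rewrite mxE.
have n0 : n%:R != 0 :> R by rewrite pnatr_eq0; case: (n) u {v Buv} => [[]|].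
have M1 i : Mbar i != 0 by rewrite gt_eqF.
apply: mulf_neq0; first by rewrite invr_neq0 // mulf_neq0 // gt_eqF.
by rewrite mulf_neq0 // invr_neq0 // mulf_neq0.
Qed.

(** A symmetric matrix with no eigenvalue other than 0 has operator norm 0, so all its entries
    vanish. *)
Lemma spectrum_neq0 n (X : 'M[R]_n) u v : X^T = X -> X u v != 0 ->
  exists2 z, spectrum X z & z != 0.
Proof.
move=> Xs Xuv; apply: contrapT => nz.
have X0 z : spectrum X z -> z = 0.
  by move=> Xz; apply/eqP; apply: contrapT => /negP z0; apply: nz; exists z.
have r0 : spectral_radius X <= 0.
  rewrite /spectral_radius; have [[z Xz]|s0] := pselect (spectrum X !=set0).
    apply: ge_sup; first by exists (complex.Re `|z|), z.
    by move=> _ [w /X0 -> <-]; rewrite normr0.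
  suff -> : spectrum X = set0 by rewrite image_set0 sup0.
  by apply/seteqP; split => // z Xz; apply: s0; exists z.
have := op_bounded_le r0 (op_bounded_spectral_radius Xs).
move=> /(_ (delta_mx u 0) (delta_mx v 0)); rewrite mul0r normr_le0.
rewrite dotvE mulmxA trmx_delta -rowE -colE !mxE => /eqP X0uv.
by rewrite X0uv eqxx in Xuv.
Qed.

Lemma spectral_gap_P_mx : (forall i, 0 < Mbar i) -> (forall k, 0 < alpha k) ->
  (exists i j, B i j != 0) ->
  exists2 delta : R, 0 < delta & forall n (S : dcsbm R K n), (K < n)%N ->
    0 < mean_weight S ->
    (forall k, #|[set u | label S u == k]%SET|%:R = alpha k * n%:R) ->
    delta / mean_weight S <= spectral_gap (P_mx B S Mbar).
Proof.
move=> M0 a0 [i [j Bij]].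
have [rs rsE] := closed_field_poly_normal (char_poly community_mx).
(* 0 is added to the roots: it is an eigenvalue of P for n > K, but need not be one of
   [community_mx]. *)
have [delta d0 rsd] := seq_separation (0 :: rs).
exists delta => // n S Kn D0 card_label.
have n0 : 0 < n%:R :> R by rewrite ltr0n (leq_ltn_trans _ Kn).
have labelP k : exists u, label S u = k.
  have : 0 < #|[set u | label S u == k]%SET|%:R :> R by rewrite card_label mulr_gt0.
  by rewrite ltr0n => /card_gt0P[u]; rewrite inE => /eqP; exists u.
have spec z : spectrum (P_mx B S Mbar) z ->
    (mean_weight S)%:C%C * z \in 0 :: rs.
  move=> Pz; have [->|z0] := eqVneq z 0; first by rewrite mulr0 mem_head.
  have := spectrum_P_mx D0 card_label Pz z0.
  have lc : lead_coef (char_poly community_mx) != 0.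
    by rewrite (monicP (char_poly_monic _)) oner_neq0.
  rewrite eigenvalue_root_char rsE rootZ // root_prod_XsubC inE => ->.
  by rewrite orbT.
apply: spectral_gap_ge.
  have [u lu] := labelP i; have [v lv] := labelP j.
  have [|z Pz z0] := @spectrum_neq0 _ (P_mx B S Mbar) u v (P_mx_sym S).
    by apply: P_mx_neq0; rewrite ?lu ?lv.
  by exists z, 0; split; [exact: Pz|exact: (spectrum_P_mx_0 S Kn)|exact: z0].
move=> z w Pz Pw zw; rewrite ler_pdivrMr // mulrC.
rewrite -[mean_weight S]gtr0_norm // -Re_norm_real -Re_normM mulrBr.
apply: rsd; rewrite ?spec //.
apply: contra zw => /eqP/mulfI e; apply/eqP/e.
by apply/eqP => /(congr1 (@complex.Re R)) /= /eqP; rewrite gt_eqF.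
Qed.

End PMatrix.

(** * Large models *)

Lemma expR_ge_sqr (R : realType) (x : R) : 0 <= x -> x ^+ 2 / 4 <= expR x.
Proof.
move=> x0; have -> : x = x / 2 + x / 2 by field.
rewrite expRD; have := expR_ge1Dx (x / 2); nra.
Qed.

Lemma sqrt_expR_ge (R : realType) (x : R) : 0 <= x -> x / 2 <= Num.sqrt (expR x).
Proof.
move=> x0; rewrite -[leLHS]ger0_norm ?divr_ge0 // -sqrtr_sqr ler_wsqrtr //.
by apply: le_trans (expR_ge_sqr x0); rewrite expr_div_n; lra.
Qed.

(** Each pair of steps contributes [Th ^+ 2 * sqrt (2 / r)], at most e^(-2) by the last hypothesis.
    At least [L] such pairs absorb the factor [expR L] and leave [expR (- L)]. *)
Lemma trace_tail_small (R : realType) (L r t : R) (q : nat) :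
  0 < r -> 0 < t -> L <= q%:R -> ((2 * r / t) ^+ 2 * expR 2) ^+ 2 <= r / 2 ->
  expR L * (2 * r) ^+ (2 * q) * Num.sqrt (2 / r) ^+ q / t ^+ (2 * q)
    <= expR (- L).
Proof.
move=> r0 t0 Lq; set Th := 2 * r / t => hr.
have e0 : 0 < expR 2 :> R := expR_gt0 _.
have r2 : 0 < r / 2 by rewrite divr_gt0.
have k1 : Th ^+ 2 * Num.sqrt (2 / r) <= expR (- 2).
  have -> : 2 / r = (r / 2)^-1 by rewrite invf_div.
  rewrite sqrtrV ?(ltW r2) // expRN ler_pdivrMr ?sqrtr_gt0 // mulrC ler_pdivlMr //.
  have Th0 : 0 <= Th ^+ 2 * expR 2 by rewrite mulr_ge0 ?sqr_ge0 ?(ltW e0).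
  rewrite -[leLHS]ger0_norm //.
  by rewrite -sqrtr_sqr ler_wsqrtr.
have -> : expR L * (2 * r) ^+ (2 * q) * Num.sqrt (2 / r) ^+ q / t ^+ (2 * q) =
    expR L * (Th ^+ 2 * Num.sqrt (2 / r)) ^+ q.
  rewrite /Th [in RHS]exprMn -!exprM [in RHS]expr_div_n; ring.
have h : (Th ^+ 2 * Num.sqrt (2 / r)) ^+ q <= expR (- (2 * L)).
  apply: (@le_trans _ _ (expR (- 2) ^+ q)).
    apply: lerXn2r => //; rewrite nnegrE ?expR_ge0 //.
    by apply: mulr_ge0; [exact: sqr_ge0|exact: sqrtr_ge0].
  by rewrite -expRM_natl ler_expR; lra.
have -> : - L = L + - (2 * L) by ring.
by rewrite expRD ler_wpM2l ?expR_ge0.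
Qed.

Section LargeModel.
Context {R : realType}.
Variables (mu beta k eta : R).
Hypotheses (mu_gt0 : 0 < mu) (beta_gt0 : 0 < beta) (k_gt0 : 0 < k)
  (eta_gt0 : 0 < eta).

(** [Theta] is the ratio [2 * r / t] of the trace bound, from which log n cancels. The other two
    constants are tuned to [W_mx_bounded]: [s], with [eta3 = s ^+ 2], makes the degree term
    [eta / 4], and [xi0] makes the off-diagonal part of EH - P at most [eta / 4] while staying below
    [mu / 2]. *)
Let Theta := 512 * (beta * k + 16) / (eta * mu ^+ 2 * k).
Let s := eta * mu ^+ 2 / (320 * beta).
Let xi0 := Num.min (mu / 2) (eta * mu ^+ 3 / (24 * beta)).

(** A sum in place of a maximum, all terms being nonnegative. In order they serve for l >= 1,
    [tau <= 1], the trace bound, 1/n <= [eta / 3], the variance of degrees, [D1^-1 <= xi0 / 2] and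
    the diagonal of EH - P. *)
Definition log_threshold : R :=
  1 + 4 * beta * k + (Theta ^+ 2 * expR 2) ^+ 2 + 3 / eta
  + 3 / (8 * s ^+ 2 * eta) + mu / xi0 + 8 * beta / (mu ^+ 2 * eta).

(** The other half of [xi0] is left for [D1^-1]. *)
Definition rate_threshold : R := xi0 / 2.

Let xi0_gt0 : 0 < xi0.
Proof. by rewrite lt_min !divr_gt0 ?mulr_gt0 ?exprn_gt0. Qed.

Lemma rate_threshold_gt0 : 0 < rate_threshold.
Proof. by rewrite divr_gt0. Qed.

Lemma log_thresholdP (L : R) : log_threshold <= L ->
  [/\ 1 <= L, 4 * beta * k <= L, (Theta ^+ 2 * expR 2) ^+ 2 <= L & 3 / eta <= L]
  /\ [/\ 3 / (8 * s ^+ 2 * eta) <= L, mu / xi0 <= L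
      & 8 * beta / (mu ^+ 2 * eta) <= L].
Proof.
rewrite /log_threshold.
have a1 : 0 <= 4 * beta * k by rewrite !mulr_ge0 ?ltW.
have a2 : 0 <= (Theta ^+ 2 * expR 2) ^+ 2 by rewrite sqr_ge0.
have a3 : 0 <= 3 / eta by rewrite divr_ge0 ?ltW.
have s0 : 0 < s by rewrite /s divr_gt0 ?mulr_gt0 ?exprn_gt0.
have a4 : 0 <= 3 / (8 * s ^+ 2 * eta).
  apply: divr_ge0 => //; apply: mulr_ge0; last exact: ltW.
  by apply: mulr_ge0 => //; exact: sqr_ge0.
have a5 : 0 <= mu / xi0 by apply: divr_ge0; exact: ltW.
have a6 : 0 <= 8 * beta / (mu ^+ 2 * eta).
  by apply: divr_ge0; rewrite !mulr_ge0 ?exprn_ge0 ?ltW.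
move: (4 * beta * k) (_ ^+ 2) (3 / eta) (3 / _) (mu / xi0) (8 * beta / _)
  a1 a2 a3 a4 a5 a6 => x1 x2 x3 x4 x5 x6 *.
by split; split; lra.
Qed.

Variables (K n : nat) (B : 'M[R]_K) (S : dcsbm R K n.+1) (Mbar : 'I_K -> R).
Variables (rho D1 : R).
Hypothesis B_sym : forall i j, B i j = B j i.
Hypothesis B_ge0 : forall i j, 0 <= B i j.
Hypothesis B_le : forall i j, B i j <= beta.
Hypothesis Mbar_ge : forall i, mu <= Mbar i.
Hypothesis w_ge : forall u, D1 <= weight S u.
Hypothesis p_le1 : forall u v, edge_prob B S u v <= 1.
Hypothesis Msum_close : forall i, `|Msum B S i / total_weight S - Mbar i| <= rho.
Local Notation L := (ln n.+1%:R : R).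
Hypothesis L_ge : log_threshold <= L.
Hypothesis rho_le : rho <= rate_threshold.
Hypothesis D1_ge : 16 / mu * L <= D1.
Hypothesis D1_sqr : k * L <= D1 ^+ 2 / mean_weight S.

Lemma graph_prob_W_mx_bounded :
  graph_prob B S (fun G => ~ op_bounded (W_mx B S Mbar G) (eta / mean_weight S))
  <= eta.
Proof.
move: mu_gt0 beta_gt0 k_gt0 eta_gt0 xi0_gt0 => m0 b0 k0 e0 x0.
have [[L1 L2 L3 L4] [L5 L6 L7]] := log_thresholdP L_ge.
have NL : expR L = n.+1%:R by rewrite lnK // posrE ltr0n.
move: D1_ge D1_sqr NL L1 L2 L3 L4 L5 L6 L7.
move: (ln n.+1%:R) => l Dl Dsq NL L1 L2 L3 L4 L5 L6 L7.
have l0 : 0 < l by lra.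
have D10 : 0 < D1 by apply: lt_le_trans Dl; rewrite mulr_gt0 // divr_gt0.
have Db0 := mean_weight_gt0 D10 w_ge.
have s0 : 0 < s by rewrite /s divr_gt0 ?mulr_gt0 ?exprn_gt0.
have N0 : 0 < n.+1%:R :> R by rewrite ltr0n.
have D1i : D1^-1 <= xi0 / 2.
  have : mu / (16 * l) <= xi0 / 2.
    move: L6; rewrite ler_pdivrMr // => h; rewrite ler_pdivrMr ?mulr_gt0 //; nra.
  apply: le_trans; rewrite -[leRHS]invrK lef_pV2 ?posrE ?invr_gt0 ?divr_gt0 ?mulr_gt0 //.
  by apply: le_trans Dl; rewrite invf_div mulrAC.
have xi_ge : rho + D1^-1 <= xi0 by have := rho_le; rewrite /rate_threshold; lra.
have xi_le : xi0 <= mu / 2 by rewrite ge_min lexx.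
have xi_le2 : xi0 <= eta * mu ^+ 3 / (24 * beta) by rewrite ge_min lexx orbT.
(* [b] is the bound [4 / (mu ^+ 2 * D1 ^+ 2)] with [D1 ^+ 2] replaced by its lower bound
   [k * l * mean_weight S]. Then [t] is forced by [b * t = eta / 64 / mean_weight S], which the
   factor 16 of [W_mx_bounded] turns into a quarter of the allowance. In [r], [beta * k * l] is
   [tau] times the number of vertices, and [16 * l] covers [8 * q] since q <= l + 1 <= 2 l. *)
pose b := 4 / (mu ^+ 2 * k * l * mean_weight S).
pose t := eta / 64 * (mu ^+ 2 * k * l / 4).
pose tau := beta * k * l / n.+1%:R.
pose r := (beta * k + 16) * l.
pose q := (Num.truncn l).+1.
have /andP[q1 q2] := truncn_itv (ltW l0).
have bk0 : 0 < beta * k by rewrite mulr_gt0.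
have lq : l <= q%:R by exact: ltW.
have ql : q%:R <= l + 1 by rewrite /q -natr1 lerD2r.
have mkl0 : 0 < mu ^+ 2 * k * l by rewrite !mulr_gt0 ?exprn_gt0.
have den0 : 0 < mu ^+ 2 * k * l * mean_weight S by exact: mulr_gt0.
have bgt0 : 0 < b by exact: divr_gt0.
have tgt0 : 0 < t by rewrite /t !mulr_gt0 ?exprn_gt0 ?invr_gt0.
have kD : k * l * mean_weight S <= D1 ^+ 2 by rewrite -ler_pdivlMr.
have pi1 : graph_prob B S (fun G => ~ op_bounded (H_mx B S G - EH_mx B S) (b * t))
    <= eta / 3.
  have r0 : 0 < r by rewrite /r mulr_gt0 // addr_gt0.
  apply: (@le_trans _ _ (expR (- l))); last first.
    rewrite expRN NL; apply: (@le_trans _ _ l^-1).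
      rewrite lef_pV2 ?posrE // -NL; have := expR_ge1Dx l; lra.
    rewrite -[leRHS]invrK lef_pV2 ?posrE ?invr_gt0 ?divr_gt0 //.
    by rewrite invf_div.
  have ThE : 2 * r / t = Theta.
    by rewrite /r /t /Theta; field; rewrite !gt_eqF.
  apply: le_trans (trace_tail_small r0 tgt0 lq _); last first.
    by rewrite ThE; apply: le_trans L3 _; rewrite /r; nra.
  rewrite NL; apply: (graph_prob_H_EH B_sym B_ge0 B_le m0 Mbar_ge D10 w_ge p_le1
    Msum_close xi_ge xi_le bgt0 (tau := tau)) => //.
  - have D12 : 0 < mu ^+ 2 * D1 ^+ 2 by rewrite mulr_gt0 ?exprn_gt0.
    rewrite /b ler_pM2l // lef_pV2 ?posrE //.
    have -> : mu ^+ 2 * k * l * mean_weight S = mu ^+ 2 * (k * l * mean_weight S).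
      by ring.
    by rewrite ler_pM2l ?exprn_gt0.
  - rewrite -mean_weight_total /b /tau.
    have -> : 16 * beta / (mu ^+ 4 * D1 ^+ 2 * (n.+1%:R * mean_weight S) *
      (4 / (mu ^+ 2 * k * l * mean_weight S)) ^+ 2) =
      beta * k * l / n.+1%:R * (k * l * mean_weight S / D1 ^+ 2).
      by field; rewrite ?nat1r !gt_eqF ?Db0 ?D10 ?N0.
    apply: ler_piMr; last by rewrite ler_pdivrMr ?exprn_gt0 // mul1r.
    by rewrite divr_ge0 ?mulr_ge0 ?(ltW k0) ?(ltW b0) ?(ltW l0) ?(ltW N0).
  - rewrite /tau ler_pdivrMr // mul1r -NL.
    by apply: le_trans (expR_ge_sqr (ltW l0)); nra.
  - by rewrite /r; nra.
  - by rewrite /tau divfK ?gt_eqF // /r; lra.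
have pi2 : graph_prob B S (fun G => ~ forall u, mean_degree B S u / 4 <=
    Defs.degree R G u) <= eta / 3.
  apply: le_trans (graph_prob_some_degree_small B_sym B_ge0 m0 Mbar_ge D10 w_ge p_le1
    Msum_close xi_ge xi_le) _.
  (* The constant [16 / mu] originates here: the union bound over n = [expR l] vertices needs
     failure probabilities of at most [expR (- (2 * l))]. *)
  have h : 2 * l <= D1 * mu / 8.
    by move: Dl; rewrite mulrAC ler_pdivrMr //; lra.
  apply: (@le_trans _ _ (expR (- l))).
    by rewrite -NL -expRD ler_expR; lra.
  rewrite expRN NL; apply: (@le_trans _ _ l^-1).
    rewrite lef_pV2 ?posrE // -NL; have := expR_ge1Dx l; lra.
  rewrite -[leRHS]invrK lef_pV2 ?posrE ?invr_gt0 ?divr_gt0 //.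
  by rewrite invf_div.
have pi3 : graph_prob B S (fun G => s ^+ 2 * n.+1%:R <=
    \sum_u ((Defs.degree R G u - mean_degree B S u) / mean_degree B S u) ^+ 2)
    <= eta / 3.
  apply: le_trans (graph_prob_degree_variance B_sym B_ge0 m0 Mbar_ge D10 w_ge p_le1
    Msum_close xi_ge xi_le _) _; first by rewrite exprn_gt0.
  have s2 : 0 < s ^+ 2 by rewrite exprn_gt0.
  have h : 16 * l <= mu * D1.
    by move: Dl; rewrite mulrAC ler_pdivrMr // [mu * _]mulrC.
  have ms : 0 < mu * D1 * s ^+ 2 by apply: mulr_gt0 => //; exact: mulr_gt0.
  have es : 0 < 8 * s ^+ 2 * eta by apply: mulr_gt0 => //; exact: mulr_gt0.
  rewrite ler_pdivrMr //; move: L5; rewrite ler_pdivrMr // => L5.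
  have se : 0 <= s ^+ 2 * eta by apply/ltW/mulr_gt0.
  have := ler_wpM2r se h; lra.
have p01 := vpair_prob01 B_ge0 D10 w_ge p_le1.
have -> : eta = eta / 3 + (eta / 3 + eta / 3) by field.
apply: le_trans (lerD pi1 (lerD pi2 pi3)).
apply: le_trans (le_trans (graph_prob_or p01 _ _) _); last first.
  apply: lerD (lexx _) _; exact: graph_prob_or.
apply: graph_prob_le => // G.
have -> : eta / 3 + (eta / 3 + eta / 3) = eta by field.
move=> nb; have [hA|] := pselect (op_bounded (H_mx B S G - EH_mx B S) (b * t)); last by left.
right; have [hB|] := pselect (forall u, mean_degree B S u / 4 <= Defs.degree R G u); last by left.
right; rewrite leNgt; apply/negP => hC; apply: nb.
have btE : b * t = eta / 64 / mean_weight S.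
  by rewrite /b /t; field; rewrite !gt_eqF.
rewrite btE in hA.
have e64 : 0 <= eta / 64 by rewrite divr_ge0 // ltW.
have := W_mx_bounded B_sym B_ge0 B_le m0 Mbar_ge D10 w_ge p_le1 Msum_close xi_ge xi_le
  e64 (sqr_ge0 s) hA hB (ltW hC).
apply: op_bounded_le; rewrite ler_pM2r ?invr_gt0 //.
rewrite sqrtr_sqr gtr0_norm //.
have c2 : 80 * beta / mu ^+ 2 * s = eta / 4 by rewrite /s; field; rewrite !gt_eqF.
have c3 : 6 * beta * xi0 / mu ^+ 3 <= eta / 4.
  rewrite ler_pdivrMr ?exprn_gt0 //; move: xi_le2; rewrite ler_pdivlMr ?mulr_gt0 //.
  by move=> h; lra.
have c4 : beta / mu ^+ 2 / Num.sqrt n.+1%:R <= eta / 4.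
  have sN : l / 2 <= Num.sqrt n.+1%:R by rewrite -NL sqrt_expR_ge // ltW.
  have sN0 : 0 < Num.sqrt n.+1%:R :> R by rewrite sqrtr_gt0.
  rewrite ler_pdivrMr // ler_pdivrMr ?exprn_gt0 //.
  move: L7; rewrite ler_pdivrMr ?mulr_gt0 ?exprn_gt0 // => L7.
  have : l / 2 * (mu ^+ 2 * eta) <= Num.sqrt n.+1%:R * (mu ^+ 2 * eta).
    by rewrite ler_wpM2r // mulr_ge0 ?exprn_ge0 ?ltW.
  lra.
lra.
Qed.

End LargeModel.

(** * The eigenvectors of Hhat *)

(** At index [m] the largest k <= m is taken for which the bound with tolerance 1 / (k + 1) already
    holds. The case k = 0 asks only for [0 <= F m 1], so that there is always a choice, and every
    fixed k is eventually admissible. *)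
Lemma diagonal_rate (R : realType) (F : nat -> R -> R) :
  (forall m, 0 <= F m 1) ->
  (forall eta, 0 < eta -> exists m0, forall m, (m0 <= m)%N -> 1 - eta <= F m eta) ->
  exists eps : nat -> R, [/\ forall m, 0 < eps m, eps @ \oo --> (0 : R) &
    forall m, 1 - eps m <= F m (eps m)].
Proof.
move=> F1 Flim; pose h k : R := k.+1%:R^-1.
pose good m (k : 'I_m.+1) := 1 - h k <= F m (h k).
have good0 m : @good m ord0 by rewrite /good /h invr1 subrr.
pose kk m : 'I_m.+1 := [arg max_(k > ord0 | @good m k) k]%N.
have kkP m : @good m (kk m) /\ forall k, @good m k -> (k <= kk m)%N.
  by rewrite /kk; case: arg_maxnP => // i gi imax; split.
exists (fun m => h (kk m)); split => [m||m]; last by have [] := kkP m.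
  by rewrite /h invr_gt0.
apply/cvgrPdist_lt => e e0.
pose k0 := Num.truncn e^-1.
have hk0 : h k0 < e.
  rewrite /h -[ltRHS]invrK ltf_pV2 ?posrE ?invr_gt0 //; exact: truncnS_gt.
have [|m0 m0P] := Flim (h k0); first by rewrite /h invr_gt0.
exists (maxn m0 k0) => // m /=; rewrite geq_max => /andP[m0m k0m].
rewrite sub0r normrN gtr0_norm ?invr_gt0 //; apply: le_lt_trans hk0.
rewrite /h lef_pV2 ?posrE // ler_nat ltnS.
have := (kkP m).2 (Ordinal (k0m : (k0 < m.+1)%N)); apply; exact: m0P.
Qed.

Lemma strictly_increasing_ge (N : nat -> nat) :
  {homo N : m1 m2 / (m1 < m2)%N} -> forall m, (m <= N m)%N.
Proof.
by move=> incr; elim=> // m IH; exact: leq_ltn_trans IH (incr _ _ (ltnSn m)).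
Qed.

Lemma Hhat_mx_sym (R : realType) n (G : graph n) : (Hhat_mx R G)^T = Hhat_mx R G.
Proof.
by apply/matrixP => u v; rewrite !mxE adjacentC [Defs.degree R G v * _]mulrC.
Qed.

Lemma H_mx_sym (R : realType) K n (B : 'M[R]_K) (S : dcsbm R K n) G :
  (H_mx B S G)^T = H_mx B S G.
Proof.
by apply/matrixP => u v; rewrite !mxE adjacentC [mean_degree B S v * _]mulrC.
Qed.

Lemma EH_mx_sym (R : realType) K n (B : 'M[R]_K) (S : dcsbm R K n) :
  (EH_mx B S)^T = EH_mx B S.
Proof.
apply/matrixP => u v; rewrite !mxE; apply: expect_eq => G.
by rewrite -[in LHS]H_mx_sym mxE.
Qed.

Lemma spectral_radius_W_mx (R : realType) K n (B : 'M[R]_K) (S : dcsbm R K n)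
    (Mbar : 'I_K -> R) (G : graph n) :
  (forall i j, B i j = B j i) ->
  spectral_radius (W_mx B S Mbar G)
    <= spectral_radius (Hhat_mx R G - H_mx B S G)
       + spectral_radius (H_mx B S G - EH_mx B S)
       + spectral_radius (EH_mx B S - P_mx B S Mbar).
Proof.
move=> B_sym; have subsym (X Y : 'M[R]_n) : X^T = X -> Y^T = Y -> (X - Y)^T = X - Y.
  by move=> Xs Ys; rewrite linearB /= Xs Ys.
have Hs := H_mx_sym B S G; have Es := EH_mx_sym B S.
have Ps := P_mx_sym Mbar B_sym S; have Hhs := Hhat_mx_sym R G.
have -> : W_mx B S Mbar G = (Hhat_mx R G - H_mx B S G)
    + (H_mx B S G - EH_mx B S) + (EH_mx B S - P_mx B S Mbar).
  by rewrite /W_mx !addrA !subrK.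
apply: le_trans (spectral_radiusD _ _) _; rewrite ?subsym //.
  by rewrite linearD /= !subsym.
by rewrite lerD2r; apply: spectral_radiusD; exact: subsym.
Qed.

(** The perturbation bound and the gap both carry the factor [1 / mean_weight S], which cancels in
    their quotient. As W is symmetric, its spectral radius can be the perturbation size in
    [davis_kahan]. *)
Lemma normed_eigenvector_close (R : realType) K n (B : 'M[R]_K) (S : dcsbm R K n)
    (Mbar : 'I_K -> R) (G : graph n) (delta eps : R) :
  (forall i j, B i j = B j i) -> 0 < delta -> 0 <= eps -> 0 < mean_weight S ->
  delta / mean_weight S <= spectral_gap (P_mx B S Mbar) ->
  op_bounded (W_mx B S Mbar G) (eps / mean_weight S) ->
  4 * (eps / delta) ^+ 2 < 1 ->
  let q := (spectral_radius (W_mx B S Mbar G) / spectral_gap (P_mx B S Mbar)) ^+ 2 in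
  (forall xhat, normed_eigenvector (Hhat_mx R G) xhat ->
     exists2 x, normed_eigenvector (P_mx B S Mbar) x & `|1 - dotv xhat x| <= 4 * q)
  /\ 4 * q <= 4 * (eps / delta) ^+ 2.
Proof.
move=> B_sym delta0 eps0 D0 gap Wb eps1 q.
have gap0 : 0 < spectral_gap (P_mx B S Mbar) by apply: lt_le_trans gap; rewrite divr_gt0.
have Ws : (W_mx B S Mbar G)^T = W_mx B S Mbar G.
  by rewrite /W_mx linearB /= (P_mx_sym Mbar B_sym) Hhat_mx_sym.
have eD0 : 0 <= eps / mean_weight S by rewrite divr_ge0 // ltW.
have rW := spectral_radius_le eD0 Wb.
have rW0 := spectral_radius_ge0 (W_mx B S Mbar G).
have qle : 4 * q <= 4 * (eps / delta) ^+ 2.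
  rewrite ler_pM2l // lerXn2r ?nnegrE ?divr_ge0 ?(ltW gap0) ?(ltW delta0) //.
  rewrite ler_pdivrMr //.
  apply: (le_trans rW); rewrite -mulrA ler_wpM2l //.
  by rewrite -(ler_pM2l delta0) mulrA divff ?gt_eqF // mul1r.
split => // xh xhE; apply: (davis_kahan (P_mx_sym Mbar B_sym S) rW0
  (op_bounded_spectral_radius Ws) gap0 (le_lt_trans qle eps1)).
by rewrite /W_mx addrC subrK.
Qed.

(* [rate n] bounds |M_i / sum_l D_l - Mbar_i| in the model with n vertices.
   Since the numbers alpha_k n are integers, only some n are possible: the m-th
   model of the sequence has (N m).+1 vertices, with N strictly increasing. *)
Theorem lemma5p6 (R : realType) (K : nat) (B : 'M[R]_K) (Mbar : 'I_K -> R)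
    (rate : nat -> R)
    (B_sym : forall i j, B i j = B j i)
    (B_ge0 : forall i j, 0 <= B i j)
    (Mbar_gt0 : forall i, 0 < Mbar i)
    (rate_cvg0 : rate @ \oo --> (0 : R)) :
  exists C : R, 0 < C /\
  forall (alpha d : 'I_K -> R) (N : nat -> nat)
    (S : forall m, dcsbm R K (N m).+1),
  let n m := (N m).+1 in
  let D m := weight (S m) in
  let D1 m := D m ord0 in
  let Dn m := D m ord_max in
  let Dbar m := mean_weight (S m) in
  (forall k, 0 < alpha k) ->
  \sum_k alpha k = 1 ->
  {homo N : m1 m2 / (m1 < m2)%N} ->
  (forall m k, #|[set u | label (S m) u == k]%SET|%:R = alpha k * (n m)%:R) ->
  (forall m u, 0 < D m u) ->
  (forall m (u v : 'I_(n m)), (u <= v)%N -> D m u <= D m v) ->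
  (forall i, Mbar i = \sum_k B i k * alpha k * d k) ->
  (forall m i, `|Msum B (S m) i / total_weight (S m) - Mbar i| <= rate (n m)) ->
  (* (i) *)
  (forall m u v, edge_prob B (S m) u v <= 1) ->
  (* (ii) *)
  (forall i, d i != 0 /\
     (fun m => community_mean_weight (S m) alpha i / Dbar m) @ \oo --> d i) ->
  (* (iii) *)
  (forall i l, i != l -> exists j, B i j / Mbar i != B l j / Mbar l) ->
  (* (iv) *)
  (fun m => D1 m ^+ 2 / Dbar m) =Omega_\oo (fun m => ln (n m)%:R) ->
  (* (v) *)
  ((fun m => D1 m / ln (n m)%:R) @ \oo --> +oo
   \/ (forall m, C * ln (n m)%:R <= D1 m)
      /\ exists2 c : R, c < 2^-1 &
           (fun m => Dn m ^+ 2 / ((n m)%:R `^ c)) @ \oo --> (0 : R)) ->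
  let P m := P_mx B (S m) Mbar in
  let W m := W_mx B (S m) Mbar in
  let H m := H_mx B (S m) in
  let EH m := EH_mx B (S m) in
  (exists (c : R) (eps : nat -> R),
     eps @ \oo --> (0 : R) /\
     with_high_probability B S (fun m G =>
       let q := (spectral_radius (W m G) / spectral_gap (P m)) ^+ 2 in
       (forall xhat, normed_eigenvector (Hhat_mx R G) xhat ->
          exists2 x, normed_eigenvector (P m) x
                   & `|1 - dotv xhat x| <= c * q)
       /\ c * q <= eps m))
  /\
  (forall m (G : graph (n m)),
     spectral_radius (W m G)
       <= spectral_radius (Hhat_mx R G - H m G)
          + spectral_radius (H m G - EH m)
          + spectral_radius (EH m - P m)).
Proof.
have [mu mu0 Mbar_ge0] := @seq_positive_lower_bound R [seq Mbar i | i <- enum 'I_K]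
  (fun x => ltac:(by move=> /mapP[i _ ->])).
have Mbar_ge i : mu <= Mbar i by apply: Mbar_ge0; rewrite map_f ?mem_enum.
pose beta := 1 + \sum_i \sum_j B i j.
have beta0 : 0 < beta.
  by rewrite ltr_wpDr //; do 2![apply: sumr_ge0 => ? _].
have B_le i j : B i j <= beta.
  rewrite /beta (bigD1 i) //= (bigD1 j) //= addrCA -addrA lerDl.
  rewrite addr_ge0 //; first by apply: sumr_ge0.
  by rewrite addr_ge0 //; do ?[apply: sumr_ge0 => ? _].
(* Chosen before [alpha], [N] and [S]; it depends on [Mbar] through the positive lower bound
   [mu]. *)
exists (16 / mu); split; first by rewrite divr_gt0.
move=> alpha d N S n D D1 Dn Dbar alpha0 alpha1 N_incr card_label D0 D_mono
  MbarE Msum_close p_le1 dlim _ Omega V P W H EH; split; last first.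
  by move=> m G; exact: spectral_radius_W_mx.
have D1_ge m u : D1 m <= D m u by exact: D_mono.
have D10 m : 0 < D1 m by exact: D0.
have Dbar0 m : 0 < mean_weight (S m) := mean_weight_gt0 (D10 m) (D1_ge m).
have n_ge m : (m < n m)%N by rewrite ltnS; exact: strictly_increasing_ge.
(* A zero row of [B] would make the corresponding [Mbar i] vanish, and there is a row since the
   [alpha k] sum to 1. *)
have Bneq0 : exists i j, B i j != 0.
  have [i _|K0] := pickP (@predT 'I_K); last first.
    by move: alpha1; rewrite big_pred0 // => /eqP; rewrite eq_sym oner_eq0.
  exists i; apply: contrapT => Bi0; have := Mbar_gt0 i; rewrite MbarE big1 ?ltxx //.
  move=> j _; have [->|Bij] := eqVneq (B i j) 0; first by rewrite !mul0r.
  by case: Bi0; exists j.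
have [delta delta0 gap] := spectral_gap_P_mx B_sym Mbar_gt0 alpha0 Bneq0.
have [k k0 Dsq] : exists2 k : R, 0 < k &
    \forall m \near \oo, k * ln (n m)%:R <= D1 m ^+ 2 / Dbar m.
  move: Omega; rewrite eqOmegaE qualifE => /asboolP[k k0 kP]; exists k => //.
  near=> m; have : k * `|ln (n m)%:R : R| <= `|D1 m ^+ 2 / Dbar m| by near: m.
  rewrite [X in _ <= X]ger0_norm ?divr_ge0 ?sqr_ge0 ?(ltW (Dbar0 m)) //.
  by apply: le_trans; rewrite ler_wpM2l ?(ltW k0) ?ler_norm.
have ln_ge (A : R) : \forall m \near \oo, A <= ln (n m)%:R.
  exists (Num.truncn (expR A)).+1 => // m /= mA.
  rewrite -[leLHS]expRK ler_ln ?posrE ?expR_gt0 ?ltr0n //.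
  apply: (le_trans (ltW (truncnS_gt _))); rewrite ler_nat.
  exact: leq_trans mA (ltnW (n_ge m)).
have D1_ln : \forall m \near \oo, 16 / mu * ln (n m)%:R <= D1 m.
  case: V => [/cvgryPge/(_ (16 / mu)) V|[V _]]; last by near=> m; exact: V.
  near=> m; have ln0 : 0 < ln (n m)%:R :> R.
    by apply: (@lt_le_trans _ _ 1) => //; near: m; exact: ln_ge.
  by rewrite -ler_pdivlMr //; near: m.
have rate_small (r0 : R) : 0 < r0 -> \forall m \near \oo, rate (n m) <= r0.
  move=> r00; have /cvgrPdist_le/(_ _ r00)[M _ MP] := rate_cvg0.
  exists M => // m /= Mm; have := MP (n m) (leq_trans Mm (ltnW (n_ge m))).
  by rewrite sub0r normrN; apply: le_trans; exact: ler_norm.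
have p01 m e := vpair_prob01 B_ge0 (D10 m) (D1_ge m) (p_le1 m) e.
pose F m eta := graph_prob B (S m) (fun G => op_bounded (W m G) (eta / Dbar m)).
have [eps [eps0 eps_lim epsP]] : exists eps : nat -> R, [/\ forall m, 0 < eps m,
    eps @ \oo --> (0 : R) & forall m, 1 - eps m <= F m (eps m)].
  apply: diagonal_rate => [m|eta eta0]; first exact: graph_prob_ge0.
  have [M _ MP] : \forall m \near \oo, 1 - eta <= F m eta; last by exists M.
  near=> m; rewrite /F graph_probC lerD2l lerN2.
  apply: (@graph_prob_W_mx_bounded R mu beta k eta mu0 beta0 k0 eta0 _ _ B (S m) Mbar
    (rate (n m)) (D1 m)) => //.
  - exact: D1_ge.
  - by near: m; exact: ln_ge.
  - by near: m; apply: rate_small; exact: rate_threshold_gt0.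
  - by near: m.
  - by near: m.
(* 4 is the constant of [davis_kahan]. One sequence [eps] governs both the error, through [eps'],
   and the probability of failure. *)
pose eps' m := 4 * (eps m / delta) ^+ 2.
have eps'_lim : eps' @ \oo --> (0 : R).
  rewrite (_ : 0 = 4 * (0 / delta * (0 / delta))); last by rewrite mul0r mulr0 mulr0.
  apply: cvgM; first exact: cvg_cst.
  by apply: cvgM; apply: cvgM => //; exact: cvg_cst.
exists 4, eps'; split => //; apply/cvgrPdist_lt => e e0.
have /cvgrPdist_lt/(_ 1 ltr01) eps'_lt1 := eps'_lim.
have /cvgrPdist_lt/(_ e e0) eps_lt := eps_lim.
near=> m.
have eps'1 : eps' m < 1.
  have : `|0 - eps' m| < 1 by near: m; exact: eps'_lt1.
  by rewrite sub0r normrN => /ltr_normlW.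
have epse : eps m < e.
  have : `|0 - eps m| < e by near: m; exact: eps_lt.
  by rewrite sub0r normrN => /ltr_normlW.
have Km : (K < n m)%N.
  by apply: leq_ltn_trans (n_ge m); near: m; exists K.
rewrite ger0_norm; last by rewrite subr_ge0; exact: (graph_prob_le1 (p01 m)).
apply: le_lt_trans epse; rewrite lerBlDr -lerBlDl; apply: le_trans (epsP m) _.
apply: (graph_prob_le (p01 m)) => G Wb.
apply: (@normed_eigenvector_close _ _ _ _ _ _ _ delta) Wb eps'1 => //.
- exact: ltW.
- exact: gap.
Unshelve. all: by end_near. Qed.
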